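(* For each $\eta\in\{0,1\}$, as the real number $X\to\infty$, $$\sum_{p\leq X}\ \max_{\chi\in\mathcal{X}_p^*}|\Theta_p(\eta,1,\chi)|^8\leq X^{4\eta+4+o(1)},$$ where the sum is over primes $p\le X$.
   Context: For a prime $p$, $\mathcal{X}_p^*$ denotes the set of nonprincipal Dirichlet characters modulo $p$. For $\eta\in\{0,1\}$, real $x>0$ and a character $\chi$ modulo $p$, define $$\Theta_p(\eta,x,\chi)=\sum_{n=1}^\infty \chi(n)\,n^{\eta}e^{-\pi n^2x/p}.$$ *)

(* Defs.v *)
From HB Require Import structures.
From mathcomp Require Import all_boot all_order all_algebra.
From mathcomp Require Import all_classical all_reals all_analysis.
From mathcomp Require Import complex.
From mathcomp Require cyclic.
Set Implicit Arguments.
Unset Strict Implicit.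
Unset Printing Implicit Defensive.
Import Order.TTheory GRing.Theory Num.Theory.
Import numFieldNormedType.Exports.
Local Open Scope classical_set_scope.
Local Open Scope ring_scope.
Local Open Scope complex_scope.

Definition dirichlet_characters (R : realType) (q : nat) : set (int -> R[i]) :=
  [set chi | [/\ forall m n, chi (m * n) = chi m * chi n,
                 forall n, chi (n + q%:Z) = chi n
               & forall n, (chi n != 0) = coprimez n q%:Z]].

Arguments dirichlet_characters : clear implicits.

Definition principal_character (R : realType) (q : nat) : int -> R[i] :=
  fun n => (coprimez n q%:Z)%:R.

Arguments principal_character : clear implicits.

Definition nonprincipal_characters (R : realType) (q : nat) :
    set (int -> R[i]) :=
  [set chi | dirichlet_characters R q chi /\ chi <> principal_character R q].

Arguments nonprincipal_characters : clear implicits.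

(* The annotation [R[i]^o] selects the topology given by the complex modulus;
   the series converges absolutely for p, x > 0. *)
Definition Theta (R : realType) (p eta : nat) (x : R) (chi : int -> R[i]) :
    R[i] :=
  lim ((\sum_(1 <= n < N.+1)
          chi n%:Z * n%:R ^+ eta * (expR (- (pi * n%:R ^+ 2 * x / p%:R)))%:C
        : R[i]^o) @[N --> \oo]).

(* The greatest element of [A], or 0 if there is none. *)
Definition maximum (R : realType) (A : set R) : R :=
  xget 0 (A `&` ubound A).

(* There is no nonprincipal character modulo 2, and [max_Theta8 R 2 eta] is 0;
   for an odd prime the set below is finite and nonempty. *)
Definition max_Theta8 (R : realType) (p eta : nat) : R :=
  maximum [set ComplexField.Normc.normc (Theta p eta 1 chi) ^+ 8
          | chi in nonprincipal_characters R p].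

Arguments max_Theta8 : clear implicits.

Lemma maximumP (R : realType) (A : set R) :
  finite_set A -> A !=set0 -> A (maximum A) /\ ubound A (maximum A).
Proof.
move=> fA [a0 Aa0].
have [s sE] := (finite_seqP A).1 fA.
suff [m Am] : exists m, (A `&` ubound A) m.
  rewrite /maximum; case: xgetP => [y _ [//]|/(_ m)]; contradiction.
have hs : forall t : seq R, t != [::] ->
    exists2 m, m \in t & forall y, y \in t -> y <= m.
  elim=> // x t IH _; have [->|tn] := eqVneq t [::].
    by exists x => [|y]; rewrite inE // => /eqP ->.
  have [m mt mub] := IH tn.
  have [xm|mx] := leP x m.
    exists m; first by rewrite inE mt orbT.
    by move=> y; rewrite inE => /predU1P[->//|/mub].
  exists x; first by rewrite inE eqxx.
  by move=> y; rewrite inE => /predU1P[->//|/mub/le_trans]; apply; exact: ltW.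
have [|m ms mub] := hs s.
  by move: Aa0; rewrite sE /=; case: (s).
exists m; split; first by rewrite sE.
by move=> y; rewrite sE; exact: mub.
Qed.

Lemma finite_dirichlet_characters (R : realType) (q : nat) :
  (0 < q)%N -> finite_set (dirichlet_characters R q).
Proof.
case: q => // q _.
pose t := totient q.+1.
pose P : {poly R[i]} := 'X^(t.+1) - 'X.
have t0 : (0 < t)%N by rewrite totient_gt0.
have Pn0 : P != 0.
  apply/eqP => /(congr1 (fun r : {poly R[i]} => r`_t.+1)).
  rewrite coefB coefXn eqxx coefX coef0 eqSS.
  by rewrite (negbTE (lt0n_neq0 t0)) subr0 => /eqP; rewrite oner_eq0.
have [s sE] := closed_field_poly_normal P.
pose G (g : {ffun 'I_q.+1 -> seq_sub s}) : int -> R[i] :=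
  fun n => ssval (g (inord `|(n %% q.+1%:Z)%Z|%N)).
apply: (@sub_finite_set _ _ (G @` setT)); last first.
  by apply: finite_image; exact: finite_finset.
move=> chi [cM cD c0].
have c1 : chi 1 = 1.
  have : chi 1 != 0 by rewrite c0 /coprimez gcd1z.
  by move=> h; apply: (mulfI h); rewrite -cM mulr1 mulr1.
have cX (n : int) k : chi (n ^+ k) = chi n ^+ k.
  by elim: k => [|k IH]; rewrite ?expr0 ?c1 // !exprS cM IH.
have cDn (n : int) k : chi (n + (k * q.+1)%N%:Z) = chi n.
  elim: k => [|k IH]; first by rewrite mul0n addr0.
  by rewrite mulSn PoszD addrCA addrC cD.
have cDz (n k : int) : chi (n + k * q.+1%:Z) = chi n.
  case: k => k; first by rewrite -PoszM cDn.
  by rewrite -[LHS](cDn _ k.+1) NegzE mulNr -PoszM subrK.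
have cmod (n : int) : chi (n %% q.+1%:Z)%Z = chi n.
  by rewrite [in RHS](divz_eq n q.+1%:Z) addrC cDz.
have ins (k : nat) : chi k%:Z \in s.
  have : root P (chi k%:Z).
    rewrite /root /P !hornerE /= subr_eq0.
    have [->|kn0] := eqVneq (chi k%:Z) 0; first by rewrite expr0n.
    rewrite exprS -cX -[X in _ == X]mulr1; apply/eqP; congr (_ * _).
    have kc : coprime k q.+1 by move: kn0; rewrite c0.
    rewrite -cmod -[in LHS]natz.
    have -> : ((k%:R ^+ t : int) %% q.+1%:Z)%Z = (1 %% q.+1%:Z)%Z.
      rewrite -natrX natz !modz_nat; congr Posz; exact: cyclic.Euler_exp_totient.
    by rewrite cmod.
  rewrite sE rootZ; first by rewrite root_prod_XsubC.
  by rewrite lead_coef_eq0.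
exists [ffun i : 'I_q.+1 => SeqSub (ins i)] => //.
apply/funext => n; rewrite /G ffunE /= inordK.
  rewrite gez0_abs ?cmod // modz_ge0 //.
by rewrite -ltz_nat gez0_abs ?ltz_pmod // modz_ge0.
Qed.

(* Main.v *)
(** Write [S k] for the sum of [chi n * n ^ eta] over [n <= k], and [d] for the
    number of divisors. By Abel summation [Theta] is an average of the [S k]
    against the decrements of the Gaussian, whose total mass is at most 1, so by
    convexity [|Theta|^8] is at most the same average of [|S k|^8]. The fourth
    power of [S k] is a character sum of length [k^4] with coefficients at most
    [l^eta * d(l)^3]. Fourier analysis modulo [p] bounds the square of such a
    sum, for every nonprincipal [chi] at once, by the sum over [0 < a < p] of
    the squared exponential sums at [a / p], and the large sieve over [p <= Y]
    then gives [sum_p max |S k|^8 << (k^4 + Y^2) * k^(8 eta + 4) * log^65 Y].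
    The Gaussian concentrates on [k^2 <= Y], where [k^4] and [Y^2] balance.
    Since powers of [log Y] are absorbed by the [o(1)], the large sieve may be
    proved with a logarithmic loss: duality reduces it to row sums of geometric
    sums over well-spaced points. *)

Require Import Defs.
From mathcomp Require Import all_boot all_order all_algebra.
From mathcomp Require Import all_classical all_reals all_analysis.
From mathcomp Require Import complex.
From mathcomp Require cyclic.
From mathcomp Require Import ring lra zify.
Import Order.TTheory GRing.Theory Num.Theory.
Import numFieldNormedType.Exports.
Import ComplexField.Normc.
Local Open Scope classical_set_scope.
Local Open Scope ring_scope.
Set Implicit Arguments.
Unset Strict Implicit.
Unset Printing Implicit Defensive.

(** * The divisor function and its moments *)

Definition ndiv (n : nat) : nat := size (divisors n).

(** A divisor [d] of [m * n] is recovered as the product of [gcdn d m] and [d %/ gcdn d m]. The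
    second factor is coprime to [m %/ gcdn d m], hence divides [n]; so divisors of the product
    inject into pairs of divisors. *)
Lemma ndivM m n : (0 < m)%N -> (0 < n)%N -> (ndiv (m * n) <= ndiv m * ndiv n)%N.
Proof.
move=> m0 n0; rewrite /ndiv -(size_allpairs muln).
apply: uniq_leq_size (divisors_uniq _) _ => d.
rewrite -dvdn_divisors ?muln_gt0 ?m0 // => dmn.
apply/allpairsP; exists (gcdn d m, d %/ gcdn d m)%N => /=.
have g0 : (0 < gcdn d m)%N by rewrite gcdn_gt0 m0 orbT.
split; last by rewrite mulnC divnK ?dvdn_gcdl.
  by rewrite -dvdn_divisors // dvdn_gcdr.
rewrite -dvdn_divisors // -(@Gauss_dvdr _ (m %/ gcdn d m)).
  by rewrite -(@dvdn_pmul2r (gcdn d m)) // mulnAC !divnK ?dvdn_gcdl ?dvdn_gcdr.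
by rewrite /coprime -(eqn_pmul2r g0) muln_gcdl !divnK ?dvdn_gcdl ?dvdn_gcdr // mul1n.
Qed.

Lemma ndiv_dvd m n : (0 < n)%N -> (m %| n)%N -> (ndiv m <= ndiv n)%N.
Proof.
move=> n0 mn; have m0 := dvdn_gt0 n0 mn.
apply: uniq_leq_size (divisors_uniq _) _ => d.
rewrite -!dvdn_divisors // => dm; exact: dvdn_trans dm mn.
Qed.

Lemma sum_dvdn_le_ndiv n A : (0 < n)%N ->
  (\sum_(1 <= b < A) (b %| n)%N <= ndiv n)%N.
Proof.
move=> n0; rewrite -big_mkcond /= sum1_count -size_filter.
apply: uniq_leq_size; first by rewrite filter_uniq // iota_uniq.
by move=> d; rewrite mem_filter -dvdn_divisors // => /andP[].
Qed.

Lemma ndivE n N : (0 < n <= N)%N -> ndiv n = (\sum_(1 <= b < N.+1) (b %| n)%N)%N.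
Proof.
move=> /andP[n0 nN]; apply/eqP; rewrite eqn_leq sum_dvdn_le_ndiv // andbT.
rewrite -big_mkcond /= sum1_count -size_filter.
apply: uniq_leq_size (divisors_uniq _) _ => d.
rewrite -dvdn_divisors // mem_filter mem_index_iota => dn.
by rewrite dn ltnS (dvdn_gt0 n0 dn) (leq_trans (dvdn_leq n0 dn)).
Qed.

Section DivisorMoments.
Variable R : realType.

Definition harmonic_sum (N : nat) : R := \sum_(1 <= a < N.+1) a%:R^-1.

(** The weight [1 / a] is completely multiplicative, so that a sum over products [b * c] splits into
    a product of two sums. Each step in [j] thus squares the bound, and order [j] costs [2 ^ j]
    harmonic sums. *)
Definition ndiv_moment (j N : nat) : R :=
  \sum_(1 <= a < N.+1) (ndiv a ^ j)%:R / a%:R.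

Lemma sum_eq_mul (a b N : nat) : (0 < a <= N)%N -> (0 < b)%N ->
  (\sum_(1 <= c < N.+1) (a == b * c)%N)%N = (b %| a)%N :> nat.
Proof.
move=> /andP[a0 aN] b0; have [/dvdnP[c ac]|nd] := boolP (b %| a)%N; last first.
  rewrite big1 // => c _; case: eqP nd => // ->; by rewrite dvdn_mulr.
rewrite (bigD1_seq c) /= ?iota_uniq //; last first.
  rewrite mem_index_iota; move: a0 aN; rewrite ac muln_gt0 => /andP[-> _] /=.
  by rewrite ltnS; apply: leq_trans; rewrite leq_pmulr.
rewrite ac mulnC eqxx big1 // => i ic.
by rewrite eqn_pmul2l // eq_sym (negbTE ic).
Qed.

Lemma sum_pick_le (F : nat -> R) (x m n : nat) : (forall i, 0 <= F i) ->
  \sum_(m <= a < n) (a == x)%:R * F a <= F x.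
Proof.
move=> F0; have [xi|xi] := boolP (x \in index_iota m n).
  rewrite (bigD1_seq x) /= ?iota_uniq // eqxx mul1r big1 ?addr0 // => i.
  by move=> /negbTE ->; rewrite mul0r.
rewrite big_seq big1 // => i; case: (eqVneq i x) => [->|_ _]; last by rewrite mul0r.
by rewrite (negbTE xi).
Qed.

(* Write [d(a)] as the number of pairs [(b, c)] with [a = b * c], then use
   submultiplicativity of [d ^ j]. *)
Lemma ndiv_momentS j N : ndiv_moment j.+1 N <= ndiv_moment j N ^+ 2.
Proof.
pose g (a : nat) : R := (ndiv a ^ j)%:R / a%:R.
have g0 a : 0 <= g a by rewrite /g mulr_ge0 // invr_ge0.
have -> : ndiv_moment j.+1 N = \sum_(1 <= a < N.+1) \sum_(1 <= b < N.+1)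
    \sum_(1 <= c < N.+1) (a == b * c)%N%:R * g a.
  rewrite /ndiv_moment big_nat [RHS]big_nat; apply: eq_bigr => a aN.
  rewrite expnSr natrM mulrAC -/(g a) mulrC (ndivE aN) natr_sum mulr_suml.
  rewrite big_nat [RHS]big_nat; apply: eq_bigr => b /andP[b0 _].
  by rewrite -(sum_eq_mul aN b0) natr_sum mulr_suml.
rewrite exchange_big /= expr2 mulr_suml big_nat [leRHS]big_nat.
apply: ler_sum => b /andP[b0 _].
rewrite exchange_big /= mulr_sumr big_nat [leRHS]big_nat.
apply: ler_sum => c /andP[c0 _].
apply: le_trans (sum_pick_le _ _ _ _) _ => //.
rewrite /g natrM invfM mulrACA ler_wpM2r ?mulr_ge0 ?invr_ge0 //.
by rewrite -natrM ler_nat -expnMn; case: (j) => // i; rewrite leq_exp2r // ndivM.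
Qed.

Lemma harmonic_sum_ge1 N : (0 < N)%N -> 1 <= harmonic_sum N.
Proof.
move=> N0; rewrite /harmonic_sum big_nat_recl // invr1 lerDl.
by apply: sumr_ge0 => i _; rewrite invr_ge0.
Qed.

Lemma harmonic_sum_le m n : (m <= n)%N -> harmonic_sum m <= harmonic_sum n.
Proof.
move=> mn; rewrite /harmonic_sum [leRHS](@big_cat_nat _ _ _ m.+1) //= lerDl.
by apply: sumr_ge0 => i _; rewrite invr_ge0.
Qed.

Lemma ndiv_moment_le j N : (0 < N)%N -> ndiv_moment j N <= harmonic_sum N ^+ (2 ^ j).
Proof.
move=> N0; elim: j => [|j IH].
  by apply: ler_sum => a _; rewrite expn0 mul1r.
apply: le_trans (ndiv_momentS _ _) _; rewrite expnS mulnC exprM.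
apply: lerXn2r => //; rewrite nnegrE.
  by apply: sumr_ge0 => a _; rewrite mulr_ge0 // invr_ge0.
by rewrite exprn_ge0 // (le_trans _ (harmonic_sum_ge1 N0)).
Qed.

Lemma sum_ndivX_le j N : (0 < N)%N ->
  \sum_(1 <= a < N.+1) (ndiv a ^ j)%:R <= N%:R * harmonic_sum N ^+ (2 ^ j) :> R.
Proof.
move=> N0; apply: le_trans (ler_wpM2l _ (ndiv_moment_le j N0)) => //.
rewrite mulr_sumr big_nat [leRHS]big_nat; apply: ler_sum => a /andP[a0 aN].
by rewrite mulrCA ler_peMr // ler_pdivlMr ?ltr0n // mul1r ler_nat.
Qed.
End DivisorMoments.

(** * The large sieve *)

Section LargeSieveDuality.
Variables (C : numClosedFieldType) (I J : finType) (P : pred I).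
Variables (A : I -> J -> C) (c : J -> C) (M : C).

(** Schur's test combined with duality: the absolute row sums of the Gram matrix [A A^*] bound its
    norm, which is the squared norm of [A]. The general form serves three times: for the large
    sieve, for Bessel's inequality and for Cauchy-Schwarz. *)
Lemma large_sieve_duality : 0 < M ->
  (forall r, P r -> \sum_(s | P s) `|\sum_j A r j * (A s j)^*| <= M) ->
  \sum_(r | P r) `|\sum_j A r j * c j| ^+ 2 <= M * \sum_j `|c j| ^+ 2.
Proof.
move=> M0 rowM.
pose F r := \sum_j A r j * c j.
pose G j := \sum_(r | P r) (F r)^* * A r j.
pose K r s := \sum_j A r j * (A s j)^*.
pose B := \sum_(r | P r) `|F r| ^+ 2.
pose S := \sum_j `|c j| ^+ 2.
have KC r s : `|K r s| = `|K s r|.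
  rewrite -norm_conjC /K rmorph_sum /=; congr `|_|; apply: eq_bigr => j _.
  by rewrite rmorphM /= conjCK mulrC.
have cG : \sum_j c j * G j = B.
  under eq_bigr do rewrite mulr_sumr.
  rewrite exchange_big /=; apply: eq_bigr => r _.
  rewrite normCK mulrC mulr_sumr; apply: eq_bigr => j _; ring.
have Breal : B^* = B.
  by apply/CrealP/ger0_real/sumr_ge0 => r _; rewrite exprn_ge0.
have GC j : (G j)^* = \sum_(s | P s) F s * (A s j)^*.
  by rewrite /G rmorph_sum; apply: eq_bigr => s _; rewrite rmorphM /= conjCK.
(* The quadratic form of [K] at [F] is bounded through [2 |F r| |F s| <= |F r|^2 + |F s|^2]; by the
   symmetry of [|K r s|] both halves are row sums. *)
have GM : \sum_j `|G j| ^+ 2 <= M * B.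
  have GE : \sum_j `|G j| ^+ 2 =
      \sum_(r | P r) \sum_(s | P s) (F r)^* * F s * K r s.
    under eq_bigr do rewrite normCK {1}/G mulr_suml.
    rewrite exchange_big; apply: eq_bigr => r _ /=.
    under eq_bigr do rewrite GC mulr_sumr.
    rewrite exchange_big; apply: eq_bigr => s _ /=.
    rewrite mulr_sumr; apply: eq_bigr => j _.
    ring.
  rewrite GE.
  have rowB : \sum_(r | P r) \sum_(s | P s) `|F r| ^+ 2 * `|K r s| <= M * B.
    rewrite mulr_sumr; apply: ler_sum => r Pr.
    by rewrite -mulr_sumr mulrC ler_wpM2r ?exprn_ge0 // rowM.
  have rowB' : \sum_(r | P r) \sum_(s | P s) `|F s| ^+ 2 * `|K r s| <= M * B.
    rewrite exchange_big; apply: le_trans rowB.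
    by apply: ler_sum => r _; apply: ler_sum => s _; rewrite KC.
  rewrite -[leLHS]ger0_norm; last first.
    by rewrite -GE; apply: sumr_ge0 => j _; rewrite exprn_ge0.
  suff : 2 * `|\sum_(r | P r) \sum_(s | P s) (F r)^* * F s * K r s| <=
      M * B + M * B by rewrite -mulr2n -(mulr_natl (M * B)) ler_pM2l.
  apply: le_trans (lerD rowB rowB').
  apply: le_trans (ler_wpM2l (ler0n _ 2) (ler_norm_sum _ _ _)) _ => //.
  rewrite mulr_sumr -big_split; apply: ler_sum => r _ /=.
  apply: le_trans (ler_wpM2l (ler0n _ 2) (ler_norm_sum _ _ _)) _ => //.
  rewrite mulr_sumr -big_split; apply: ler_sum => s _ /=.
  rewrite !normrM norm_conjC -mulrDl mulrA ler_wpM2r // mulr_natl.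
  rewrite -subr_ge0 addrAC -sqrrB.
  by rewrite real_exprn_even_ge0 // rpredB.
(* Expanding this nonnegative quantity plays the role of Cauchy-Schwarz. *)
have : 0 <= \sum_j `|M * c j - (G j)^*| ^+ 2.
  by apply: sumr_ge0 => j _; rewrite exprn_ge0.
have MC : M^* = M by apply/CrealP/gtr0_real.
have -> : \sum_j `|M * c j - (G j)^*| ^+ 2 =
    M ^+ 2 * S - M * B - M * B + \sum_j `|G j| ^+ 2.
  rewrite -{2}Breal -cG rmorph_sum /= !mulr_sumr -!sumrB -big_split /=.
  apply: eq_bigr => j _; rewrite !normCK !rmorphB !rmorphM /= conjCK MC; ring.
move=> H; rewrite -(ler_pM2l M0).
have := le_trans H (lerD (lexx _) GM).
by rewrite subrK subr_ge0 expr2 mulrA.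
Qed.
End LargeSieveDuality.

(** * Additive characters and geometric sums *)

Section AdditiveCharacter.
Variable R : realType.
Implicit Types x y : R.

Definition expi x : R[i] := Complex (cos (2 * pi * x)) (sin (2 * pi * x)).

Lemma expi0 : expi 0 = 1.
Proof. by rewrite /expi mulr0 cos0 sin0. Qed.

Lemma expiD x y : expi (x + y) = expi x * expi y.
Proof. by rewrite /expi mulrDr cosD sinD; simpc; congr Complex; ring. Qed.

Lemma expiMn x n : expi (x *+ n) = expi x ^+ n.
Proof. by elim: n => [|n IH]; rewrite ?mulr0n ?expi0 // mulrS expiD IH exprS. Qed.

Lemma expi_nat n : expi n%:R = 1.
Proof.
by rewrite -[n%:R]/(1 *+ n) expiMn /expi mulr1 mulr_natl cos2pi sin2pi expr1n.
Qed.

Lemma conj_expi x : (expi x)^* = expi (- x).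
Proof. by rewrite /expi mulrN cosN sinN. Qed.

Lemma norm_expi x : `|expi x| = 1.
Proof. by rewrite normc_def /= cos2Dsin2 sqrtr1. Qed.

Lemma norm_1Bexpi x : `|1 - expi x| = (2 * `|sin (pi * x)|)%:C%C.
Proof.
rewrite normc_def /= sub0r sqrrN; congr (_%:C)%C.
have -> : (1 - cos (2 * pi * x)) ^+ 2 + sin (2 * pi * x) ^+ 2 =
    (2 * sin (pi * x)) ^+ 2.
  have -> : (1 - cos (2 * pi * x)) ^+ 2 + sin (2 * pi * x) ^+ 2 =
     2 - 2 * cos (2 * pi * x) by have := cos2Dsin2 (2 * pi * x); nra.
  have -> : 2 * pi * x = (pi * x) *+ 2 by ring.
  by rewrite cos_mulr2n; have := cos2Dsin2 (pi * x); nra.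
by rewrite sqrtr_sqr normrM ger0_norm.
Qed.

(** The mean value theorem on [[0, x / 2]], where the cosine is at least [cos (pi / 4)], gives
    [sin (x / 2) >= cos (pi / 4) * x / 2]. Doubling the angle brings in a second factor
    [cos (pi / 4)], and the two multiply to 1/2. *)
Lemma half_le_sin x : 0 <= x <= pi / 2 -> x / 2 <= sin x.
Proof.
move=> /andP[x0 xp]; have p0 := pi_gt0 R.
have cos4 : cos (pi / 4) ^+ 2 = 1 / 2 :> R.
  have := cos_mulr2n (pi / 4 : R).
  have -> : (pi / 4) *+ 2 = pi / 2 :> R by field.
  by rewrite cos_pihalf; lra.
have cos_ge y : 0 <= y <= pi / 4 -> cos (pi / 4) <= cos y.
  move=> /andP[y0 yp]; have [yl|yl] := ltP y (pi / 4); last first.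
    have yE : y = pi / 4 by apply/le_anti; rewrite yp.
    by rewrite yE.
  by apply/ltW; rewrite ltr_cos // in_itv /=; apply/andP; split; lra.
have c40 : 0 <= cos (pi / 4) :> R by apply: cos_ge0_pihalf; apply/andP; split; lra.
have [||z zx] := @MVT_segment R sin cos 0 (x / 2).
- by lra.
- by apply: continuous_subspaceT => y; exact: continuous_sin.
rewrite sin0 !subr0 => sinE.
move: zx; rewrite in_itv /= => /andP[z0 zx].
have -> : x = (x / 2) *+ 2 by rewrite -mulr_natr divfK.
rewrite sin_mulr2n sinE.
have h1 := cos_ge z; have h2 := cos_ge (x / 2).
have {}h1 : cos (pi / 4) <= cos z by apply: h1; apply/andP; split; lra.
have {}h2 : cos (pi / 4) <= cos (x / 2) by apply: h2; apply/andP; split; lra.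
have : cos (pi / 4) ^+ 2 <= cos z * cos (x / 2) by rewrite expr2 ler_pM.
rewrite cos4 => h3.
have -> : cos (x / 2) * (cos z * (x / 2)) *+ 2 = (cos z * cos (x / 2)) * x by field.
have -> : x / 2 *+ 2 / 2 = 1 / 2 * x by field.
exact: ler_wpM2r.
Qed.

Lemma le_sin_pi x : 0 <= x <= 1 / 2 -> x <= sin (pi * x).
Proof.
move=> /andP[x0 x2]; have p2 := pi_ge2 R.
apply: le_trans (half_le_sin _); first by nra.
by apply/andP; split; nra.
Qed.

(** For [|x| < 1] the nearest integer is 0, 1 or -1, and the sine is at least the distance to it.
    Adding the three inverses avoids choosing one, and lets each be summed separately over
    well-spaced points. *)
Lemma inv_sin_pi_le x : 0 < `|x| < 1 ->
  0 < `|sin (pi * x)| /\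
  `|sin (pi * x)|^-1 <= `|x|^-1 + `|x - 1|^-1 + `|x + 1|^-1.
Proof.
wlog x0 : x / 0 < x => [th|].
  case: (ltgtP x 0) => [x0|x0|->]; [|exact: th|by rewrite normr0 ltxx].
  rewrite -normrN => /th; rewrite oppr_gt0 => /(_ x0).
  rewrite mulrN sinN !normrN => -[H1 H2]; split=> //.
  have -> : `|x - 1| = `|- x + 1| by rewrite -normrN opprB addrC.
  have -> : `|x + 1| = `|- x - 1| by rewrite -normrN opprD.
  by rewrite addrAC.
rewrite gtr0_norm // => /andP[_ x1].
have S0 : 0 < sin (pi * x).
  by apply: sin_gt0_pi; have := pi_gt0 R => p0; apply/andP; split; nra.
rewrite gtr0_norm //; split=> //.
rewrite ltr0_norm ?subr_lt0 // opprB.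
have [x2|x2] := leP x (1 / 2).
  apply: (@le_trans _ _ x^-1).
    by rewrite lef_pV2 ?posrE // le_sin_pi // x2 ltW.
  by rewrite -addrA lerDl addr_ge0 // invr_ge0 ?subr_ge0 // ltW.
apply: (@le_trans _ _ (1 - x)^-1).
  rewrite lef_pV2 ?posrE ?subr_gt0 //.
  have -> : sin (pi * x) = sin (pi * (1 - x)).
    have -> : pi * (1 - x) = - (pi * x) + pi by ring.
    by rewrite sinDpi sinN opprK.
  by apply: le_sin_pi; apply/andP; split; lra.
by rewrite addrAC lerDr addr_ge0 // invr_ge0 // ltW.
Qed.

(** The sum times [1 - expi x] is [1 - expi x ^+ N], of modulus at most 2, so the bound is uniform
    in the length [N]. *)
Lemma norm_geom_expi_le x N : 0 < `|x| < 1 ->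
  `|\sum_(m < N) expi x ^+ m| <=
  (`|x|^-1 + `|x - 1|^-1 + `|x + 1|^-1)%:C%C.
Proof.
move=> /inv_sin_pi_le[S0 H].
have n1 : `|1 - expi x| = (2 * `|sin (pi * x)|)%:C%C := norm_1Bexpi x.
have n0 : 0 < `|1 - expi x| by rewrite n1 ltcR mulr_gt0.
apply: (@le_trans _ _ (`|sin (pi * x)|^-1)%:C%C); last by rewrite lecR.
rewrite -(ler_pM2l n0) -normrM.
have -> : (1 - expi x) * (\sum_(m < N) expi x ^+ m) = 1 - expi x ^+ N.
  by rewrite -[RHS]opprB subrX1 -mulNr opprB.
rewrite n1 -rmorphM /= mulfK ?gt_eqF //.
apply: le_trans (ler_normB _ _) _.
by rewrite normr1 normrX norm_expi expr1n rmorphMn.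
Qed.

Lemma expi_neq1 x : 0 < `|x| < 1 -> expi x != 1.
Proof.
move=> /inv_sin_pi_le[S0 _]; rewrite eq_sym -subr_eq0 -normr_gt0.
by rewrite norm_1Bexpi ltcR mulr_gt0.
Qed.

End AdditiveCharacter.

Section Spaced.
Variable R : realType.

Lemma sum_inv_spaced (I : finType) (P : pred I) (z : I -> R) (J : nat) :
  (forall i, P i -> 1 <= `|z i| <= J%:R) ->
  (forall i j, P i -> P j -> i != j -> 1 <= `|z i - z j|) ->
  \sum_(i | P i) `|z i|^-1 <= 2 * harmonic_sum R J.
Proof.
move=> zb zs.
(* The sign and the integer part of [|z i|] determine [i]. *)
pose t i : bool * 'I_J.+1 := (0 <= z i, inord (Num.truncn `|z i|)).
pose F (v : bool * 'I_J.+1) : R := (v.2%:R)^-1.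
have tE i : P i -> nat_of_ord (t i).2 = Num.truncn `|z i|.
  move=> /zb /andP[_ zJ]; rewrite inordK // ltnS truncn_le_nat.
  by rewrite (le_lt_trans zJ) // ltr_nat.
have tinj : {in P &, injective t}.
  move=> i j Pi Pj tij; apply/eqP/negP => /negP ij.
  have := zs _ _ Pi Pj ij.
  have /andP[i1 i2] := truncn_itv (normr_ge0 (z i)).
  have /andP[j1 j2] := truncn_itv (normr_ge0 (z j)).
  have e : Num.truncn `|z i| = Num.truncn `|z j| by rewrite -!tE // tij.
  have s : (0 <= z i) = (0 <= z j) by case: tij.
  have : `|z i - z j| = `| `|z i| - `|z j| |.
    case: (leP 0 (z j)) s => sj /= si.
      by rewrite (ger0_norm sj) (ger0_norm si).
    have {}si : z i < 0 by rewrite ltNge si.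
    rewrite (ltr0_norm sj) (ltr0_norm si).
    by rewrite -opprD normrN.
  move=> ->; rewrite leNgt => /negP; apply.
  rewrite -e in j1 j2; rewrite ltr_norml; move: i1 i2 j1 j2.
  rewrite -natr1 => *; apply/andP; split; lra.
have le1 : \sum_(i | P i) `|z i|^-1 <= \sum_(i in P) F (t i).
  apply: ler_sum => i Pi; rewrite /F tE //.
  have /andP[z1 _] := zb _ Pi.
  have t0 : (0 < Num.truncn `|z i|)%N by rewrite truncn_gt0.
  rewrite lef_pV2 ?posrE ?ltr0n //; last exact: lt_le_trans z1.
  by have /andP[] := truncn_itv (normr_ge0 (z i)).
apply: le_trans le1 _; rewrite -(big_imset _ tinj) /=.
have F0 v : 0 <= F v by rewrite invr_ge0.
apply: le_trans (_ : \sum_v F v <= _).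
  rewrite [leRHS](bigID (mem (t @: P))) /= lerDl; exact: sumr_ge0.
rewrite -(pair_bigA _ (fun b j => F (b, j))) /= big_bool /=.
rewrite /F /= -mulr2n -[leLHS]mulr_natl ler_pM2l //.
rewrite -(big_mkord xpredT (fun j => j%:R^-1 : R)) big_ltn //.
by rewrite invr0 add0r.
Qed.
End Spaced.

(** * The large sieve for fractions with prime denominator *)

Section FareyLargeSieve.
Variable R : realType.
Variables (Y N : nat) (Y0 : (0 < Y)%N).

Definition farey_index (i : 'I_Y.+1 * 'I_Y.+1) : bool :=
  prime i.1 && (0 < i.2 < i.1)%N.

Definition farey_point (i : 'I_Y.+1 * 'I_Y.+1) : R := i.2%:R / i.1%:R.

(** The quantity is [m / (p * q)] for a nonzero integer [m], with [p * q <= Y ^ 2]. The shift [e]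
    makes this a spacing modulo 1. *)
Lemma farey_spaced (e : int) i j : farey_index i -> farey_index j -> i != j ->
  1 <= (Y ^ 2)%:R * `|farey_point i - farey_point j + e%:~R|.
Proof.
move=> /andP[p1 /andP[a0 ap]] /andP[q1 /andP[b0 bq]] ij.
rewrite /farey_point.
have ij2 : i.1 = j.1 :> nat -> i.2 != j.2 :> nat.
  move: ij; case: i j {p1 a0 ap q1 b0 bq} => [i1 i2] [j1 j2] /= ij /val_inj ij1.
  by apply: contra ij => /eqP/val_inj ->; rewrite ij1.
set p := nat_of_ord i.1 in p1 ap ij2 *; set a := nat_of_ord i.2 in a0 ap ij2 *.
set q := nat_of_ord j.1 in q1 bq ij2 *; set b := nat_of_ord j.2 in b0 bq ij2 *.
have p0 : (0 < p)%N := prime_gt0 p1; have q0 : (0 < q)%N := prime_gt0 q1.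
have pn0 : (p%:R : R) != 0 by rewrite pnatr_eq0 -lt0n.
have qn0 : (q%:R : R) != 0 by rewrite pnatr_eq0 -lt0n.
pose m : int := a%:Z * q%:Z - b%:Z * p%:Z + e * p%:Z * q%:Z.
have mE : a%:R / p%:R - b%:R / q%:R + e%:~R = m%:~R / (p * q)%:R :> R.
  rewrite /m !(rmorphD, rmorphB, rmorphM, intrD, intrM) /= ?natrM.
  by field; rewrite pn0 qn0.
(* If [m = 0] and [p = q], then [p] divides [a - b], which is nonzero and smaller than [p] in
   absolute value. If [p] and [q] differ, [p] divides [a * q], hence [a] or [q]; both are
   impossible. *)
have m0 : m != 0.
  apply/eqP => m0.
  have [pq|pq] := eqVneq p q.
    have : (p%:Z %| a%:Z - b%:Z)%Z.
      apply/dvdzP; exists (- e); apply: (@mulIf _ p%:Z).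
        by rewrite eqz_nat -lt0n.
      move: m0; rewrite /m -pq => m0; apply/eqP; rewrite -subr_eq0 -m0.
      by apply/eqP; ring.
    have ab := ij2 pq.
    rewrite dvdzE /= => /dvdn_leq; have := ltn_ord i.1; lia.
  have : (p%:Z %| a%:Z * q%:Z)%Z.
    apply/dvdzP; exists (b%:Z - e * q%:Z).
    apply/eqP; rewrite -subr_eq0 -m0; apply/eqP; rewrite /m; ring.
  rewrite -PoszM dvdzE /= Euclid_dvdM // => /orP[/(dvdn_leq a0)|].
    by rewrite leqNgt ap.
  by rewrite dvdn_prime2 // (negbTE pq).
rewrite mE normrM normfV !normr_nat mulrA ler_pdivlMr ?ltr0n ?muln_gt0 ?p0 //.
rewrite mul1r -intr_norm.
apply: le_trans (_ : (Y ^ 2)%:R <= _).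
  by rewrite ler_nat expnS expn1 leq_mul // -ltnS ltn_ord.
by rewrite ler_peMr // ler1z -gtz0_ge1 normr_gt0.
Qed.

Lemma farey_point_itv i : farey_index i -> 0 < farey_point i < 1.
Proof.
move=> /andP[p1 /andP[a0 ap]]; have p0 := prime_gt0 p1.
by rewrite /farey_point divr_gt0 ?ltr0n //= ltr_pdivrMr ?ltr0n // mul1r ltr_nat.
Qed.

(** Scaling by [Y ^ 2] makes the points 1-spaced, and they stay within [2 * Y ^ 2] of 0 because each
    difference of fractions is below 1 and [|e| <= 1]. *)
Lemma sum_inv_farey_le (e : int) r : farey_index r -> `|e| <= 1 ->
  \sum_(s | farey_index s && (s != r))
    `|farey_point r - farey_point s + e%:~R|^-1
  <= (Y ^ 2)%:R * (2 * harmonic_sum R (2 * Y ^ 2)).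
Proof.
move=> Pr e1; have Y2 : 0 < (Y ^ 2)%:R :> R by rewrite ltr0n expn_gt0 Y0.
pose z s := (Y ^ 2)%:R * (farey_point r - farey_point s + e%:~R).
have -> : \sum_(s | farey_index s && (s != r))
    `|farey_point r - farey_point s + e%:~R|^-1 =
    (Y ^ 2)%:R * \sum_(s | farey_index s && (s != r)) `|z s|^-1.
  rewrite mulr_sumr; apply: eq_bigr => s _.
  by rewrite /z normrM invfM mulrA (gtr0_norm Y2) mulfV ?mul1r // gt_eqF.
rewrite ler_pM2l //; apply: sum_inv_spaced => [s|s t] /andP[Ps sr].
  rewrite /z normrM (gtr0_norm Y2) farey_spaced //=; last by rewrite eq_sym.
  rewrite mulnC natrM ler_pM2l //.
  apply: le_trans (ler_normD _ _) _.
  have -> : 2%:R = 1 + 1 :> R by ring.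
  apply: lerD; last by rewrite -intr_norm lerz1.
  have := farey_point_itv Ps; have := farey_point_itv Pr.
  by move=> /andP[? ?] /andP[? ?]; apply/ltW; rewrite ltr_norml; apply/andP; split; lra.
move=> /andP[Pt tr] st.
rewrite /z -mulrBr normrM (gtr0_norm Y2).
have -> : farey_point r - farey_point s + e%:~R -
   (farey_point r - farey_point t + e%:~R) =
   farey_point t - farey_point s + 0%:~R by rewrite addr0; ring.
by apply: farey_spaced => //; rewrite eq_sym.
Qed.

(** In a row of the Gram matrix the diagonal gives [N]. The other entries are geometric sums,
    bounded by three families of inverse distances that cost twice [Y ^ 2] times a harmonic sum
    each; hence the 6. *)
Lemma farey_large_sieve (c : 'I_N -> R[i]) :
  \sum_(i | farey_index i)
    `|\sum_(m < N) expi (farey_point i) ^+ m * c m| ^+ 2 <=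
  (N%:R + 6 * (Y ^ 2)%:R * harmonic_sum R (2 * Y ^ 2))%:C%C *
  \sum_(m < N) `|c m| ^+ 2.
Proof.
have Y2 : (0 < Y ^ 2)%N by rewrite expn_gt0 Y0.
have H1 : 1 <= harmonic_sum R (2 * Y ^ 2).
  by apply: harmonic_sum_ge1; rewrite muln_gt0.
apply: (@large_sieve_duality R[i] _ 'I_N farey_index
  (fun r (m : 'I_N) => expi (farey_point r) ^+ m) c).
  rewrite ltcR ltr_wpDl // !mulr_gt0 ?ltr0n //; exact: lt_le_trans H1.
move=> r Pr; rewrite (bigD1 r) //= rmorphD /=; apply: lerD.
  apply: le_trans (ler_norm_sum _ _ _) _.
  under eq_bigr do rewrite normrM norm_conjC normrX norm_expi expr1n mulr1.
  by rewrite sumr_const card_ord rmorphMn.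
pose G x : R := `|x|^-1 + `|x - 1|^-1 + `|x + 1|^-1.
apply: (@le_trans _ _ (\sum_(s | farey_index s && (s != r))
    G (farey_point r - farey_point s))%:C%C).
  rewrite rmorph_sum /=; apply: ler_sum => s /andP[Ps sr].
  under eq_bigr do rewrite rmorphXn /= conj_expi -exprMn -expiD.
  apply: norm_geom_expi_le.
  have := farey_spaced 0 Pr Ps; rewrite eq_sym sr addr0 => /(_ isT) Ysp.
  rewrite normr_gt0; apply/andP; split.
    apply: contraTneq Ysp => ->; by rewrite normr0 mulr0 ler10.
  have := farey_point_itv Ps; have := farey_point_itv Pr.
  by move=> /andP[? ?] /andP[? ?]; rewrite ltr_norml; apply/andP; split; lra.
rewrite lecR !big_split /=.
have -> : 6 * (Y ^ 2)%:R * harmonic_sum R (2 * Y ^ 2) =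
  (Y ^ 2)%:R * (2 * harmonic_sum R (2 * Y ^ 2)) +
  (Y ^ 2)%:R * (2 * harmonic_sum R (2 * Y ^ 2)) +
  (Y ^ 2)%:R * (2 * harmonic_sum R (2 * Y ^ 2)) by ring.
apply: lerD; first apply: lerD.
- apply: le_trans (sum_inv_farey_le (e := 0) Pr _) => //.
  by under eq_bigr do rewrite -[X in `|X|]addr0.
- apply: le_trans (sum_inv_farey_le (e := -1) Pr _) => //.
- exact: le_trans (sum_inv_farey_le (e := 1) Pr _).
Qed.
End FareyLargeSieve.

(** * Character sums *)

Section FiniteFourier.
Variables (R : realType) (p : nat).
Hypothesis p0 : (0 < p)%N.

Local Notation w a := (expi (a%:R / p%:R : R)).

Lemma expi_fracX a : w a ^+ p = 1.
Proof.
by rewrite -expiMn -(mulr_natr (_ / _)) divfK ?expi_nat // pnatr_eq0 -lt0n.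
Qed.

Lemma expi_frac_mod a m : w a ^+ (m %% p) = w a ^+ m.
Proof.
by rewrite [in RHS](divn_eq m p) exprD mulnC exprM expi_fracX expr1n mul1r.
Qed.

Lemma expi_fracC a m : w a ^+ m = w m ^+ a.
Proof. by rewrite -!expiMn; congr expi; rewrite -(mulr_natr (_ / _)) -[RHS]mulr_natr; ring. Qed.

Lemma expi_frac_orthogonal (j k : 'I_p) :
  \sum_(a < p) w a ^+ j * (w a ^+ k)^* = (p%:R *+ (j == k)).
Proof.
have pn0 : (p%:R : R) != 0 by rewrite pnatr_eq0 -lt0n.
under eq_bigr => a _ do rewrite (expi_fracC a j) (expi_fracC a k) rmorphXn /= conj_expi -exprMn -expiD.
have [->|jk] := eqVneq j k.
  rewrite subrr expi0; under eq_bigr do rewrite expr1n.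
  by rewrite sumr_const card_ord.
have x1 : 0 < `|j%:R / p%:R - k%:R / p%:R : R| < 1.
  have pR : 0 < p%:R :> R by rewrite ltr0n.
  rewrite -mulrBl normrM normfV normr_nat ltr_pdivrMr // mul1r.
  rewrite divr_gt0 ?normr_gt0 ?subr_eq0 ?eqr_nat //= ltr_norml.
  have := ltn_ord j; have := ltn_ord k.
  rewrite -!(ltr_nat R); have := ler0n R j; have := ler0n R k.
  by move=> *; apply/andP; split; lra.
have nz : expi (j%:R / p%:R - k%:R / p%:R : R) - 1 != 0.
  by rewrite subr_eq0 expi_neq1.
apply: (mulfI nz); rewrite -subrX1 mulr0n mulr0; apply/eqP.
by rewrite subr_eq0 expiD -conj_expi exprMn -rmorphXn /= !expi_fracX conjC1 mul1r.
Qed.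

(** Expand [chi] in additive characters modulo [p]: frequency 0 drops out because [chi] sums to 0
    over a period. Cauchy-Schwarz with [parseval] then costs [p ^ 2], which cancels against the [p]
    of Fourier inversion. The right side is free of [chi], so it bounds a maximum over
    characters. *)
Lemma norm_char_sum_le (chi : nat -> R[i]) N (c : 'I_N -> R[i]) :
  (forall n, chi (n %% p)%N = chi n) -> (forall n, `|chi n| <= 1) ->
  \sum_(h < p) chi h = 0 ->
  `|\sum_(m < N) c m * chi m| ^+ 2 <=
    \sum_(a < p | (0 < a)%N) `|\sum_(m < N) w a ^+ m * c m| ^+ 2.
Proof.
move=> chip chi1 chi0.
have pC : 0 < (p%:R : R[i]) by rewrite ltr0n.
pose hat (a : 'I_p) := \sum_(h < p) (w a ^+ h)^* * chi h.
pose F (a : 'I_p) := \sum_(m < N) w a ^+ m * c m.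
have parseval : \sum_a `|hat a| ^+ 2 <= p%:R ^+ 2.
  (* [large_sieve_duality] applied to the orthogonal matrix of the Fourier
     transform is Bessel's inequality. *)
  have := @large_sieve_duality R[i] _ _ xpredT
    (fun (a h : 'I_p) => (w a ^+ h)^*) (fun h => chi h) p%:R pC.
  move=> H; apply: le_trans (H _) _ => {H} /=.
    move=> a _; under eq_bigr => b _.
      under eq_bigr => h _ do rewrite conjCK mulrC !(expi_fracC _ h).
      rewrite expi_frac_orthogonal; over.
    rewrite (bigD1 a) //= eqxx normr_nat big1 ?addr0 // => b ba.
    by rewrite (negbTE ba) normr0.
  rewrite expr2 ler_pM2l //.
  apply: le_trans (_ : \sum_(h < p) 1 <= _).
    by apply: ler_sum => h _; rewrite expr_le1.
  by rewrite sumr_const card_ord.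
have inversion (m : nat) : \sum_a hat a * w a ^+ m = p%:R * chi m.
  rewrite -(chip m); pose k := Ordinal (ltn_pmod m p0).
  under eq_bigr do rewrite -expi_frac_mod mulr_suml.
  rewrite exchange_big /= (bigD1 k) //= [X in _ + X]big1 ?addr0 => [|h hk].
    under eq_bigr do rewrite mulrAC [X in X * _]mulrC.
    by rewrite -mulr_suml (expi_frac_orthogonal k k) eqxx.
  under eq_bigr do rewrite mulrAC [X in X * _]mulrC.
  by rewrite -mulr_suml (expi_frac_orthogonal k h) eq_sym (negbTE hk) mul0r.
have sumE : p%:R * (\sum_(m < N) c m * chi m) =
    \sum_(a : 'I_p | (0 < a)%N) hat a * F a.
  transitivity (\sum_a hat a * F a).
    under [RHS]eq_bigr do rewrite mulr_sumr.
    rewrite exchange_big /= mulr_sumr; apply: eq_bigr => m _.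
    under eq_bigr do rewrite mulrA.
    by rewrite -mulr_suml inversion; ring.
  rewrite (bigID (fun a : 'I_p => (0 < a)%N)) /= [X in _ + X]big1 ?addr0 // => a.
  rewrite lt0n negbK => /eqP a0; rewrite /hat a0 mul0r expi0.
  under eq_bigr do rewrite expr1n conjC1 mul1r.
  by rewrite chi0 mul0r.
have p2 : 0 < (p%:R ^+ 2 : R[i]) by rewrite exprn_gt0.
rewrite -(ler_pM2l p2) -[in leLHS](normr_nat _ p) -exprMn -normrM sumE.
(* Extends the sum by zero to the frequency 0, to fit a statement whose columns run over the whole
   of ['I_p]. *)
pose sel (a : 'I_p) : R[i] := (0 < a)%N%:R.
(* [large_sieve_duality] for a matrix with one row is Cauchy-Schwarz. *)
have := @large_sieve_duality R[i] 'I_1 'I_p xpredT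
  (fun _ a => hat a) (fun a => sel a * F a) (p%:R ^+ 2) p2.
rewrite !big_ord1 => H; have {}H := H _.
have -> : \sum_(a : 'I_p | (0 < a)%N) hat a * F a = \sum_a hat a * (sel a * F a).
  rewrite big_mkcond; apply: eq_bigr => a _; rewrite /sel.
  by case: ifP => _; rewrite ?mul1r // mul0r mulr0.
have -> : \sum_(a < p | (0 < a)%N) `|\sum_(m < N) w a ^+ m * c m| ^+ 2 =
    \sum_a `|sel a * F a| ^+ 2.
  rewrite big_mkcond; apply: eq_bigr => a _; rewrite /sel -/(F a).
  by case: ifP => _; rewrite ?mul1r // mul0r normr0 expr0n.
apply: H => r _ /=; apply: le_trans (ler_norm_sum _ _ _) _.
by apply: le_trans parseval; apply: ler_sum => a _; rewrite normrM norm_conjC expr2.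
Qed.
End FiniteFourier.

(** * Dirichlet convolutions and the fourth power of a character sum *)

Section DirichletConvolution.

Lemma sum_eq_mul_le (a b B : nat) : (0 < a)%N -> (0 < b)%N ->
  (\sum_(1 <= c < B.+1) (a == b * c)%N <= (b %| a)%N)%N.
Proof.
move=> a0 b0; rewrite -(@sum_eq_mul a b (maxn a B)) ?a0 ?leq_maxl //.
by rewrite [leqRHS](@big_cat_nat _ _ _ B.+1) //= ?ltnS ?leq_maxr // leq_addr.
Qed.

Definition dirichlet_conv (T : pzRingType) (A B : nat) (a b : nat -> T) (l : nat) : T :=
  \sum_(1 <= m < A.+1) \sum_(1 <= n < B.+1) (l == m * n)%N%:R * (a m * b n).

Lemma sum_pick_eq (T : pzRingType) (x m n : nat) (F : nat -> T) : (m <= x < n)%N ->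
  \sum_(m <= i < n) (i == x)%:R * F i = F x.
Proof.
move=> xmn; rewrite (bigD1_seq x) /= ?iota_uniq ?mem_index_iota //.
by rewrite eqxx mul1r big1 ?addr0 // => i /negbTE ->; rewrite mul0r.
Qed.

Lemma dirichlet_conv_sum (T : comPzRingType) (A B : nat) (a b chi : nat -> T) :
  (forall m n, chi (m * n)%N = chi m * chi n) ->
  (\sum_(1 <= m < A.+1) a m * chi m) * (\sum_(1 <= n < B.+1) b n * chi n) =
  \sum_(1 <= l < (A * B).+1) dirichlet_conv A B a b l * chi l.
Proof.
move=> chiM; rewrite mulr_suml.
under [RHS]eq_bigr do rewrite mulr_suml.
rewrite exchange_big /= big_nat [RHS]big_nat; apply: eq_bigr => m /andP[m0 mA].
rewrite mulr_sumr; under [RHS]eq_bigr do rewrite mulr_suml.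
rewrite exchange_big /= big_nat [RHS]big_nat; apply: eq_bigr => n /andP[n0 nB].
under eq_bigr do rewrite -mulrA.
rewrite sum_pick_eq ?chiM; first ring.
by rewrite muln_gt0 m0 n0 /= ltnS leq_mul.
Qed.

(** Each factorization [l = m * n] contributes at most [l ^ eta * ndiv l ^ (i + j)], since [ndiv m]
    and [ndiv n] are at most [ndiv l]. The extra 1 in the exponent counts these factorizations. *)
Lemma dirichlet_conv_le (T : numDomainType) (A B eta i j : nat) (a b : nat -> T) :
  (forall m, (0 < m)%N -> 0 <= a m <= (m ^ eta * ndiv m ^ i)%:R) ->
  (forall m, (0 < m)%N -> 0 <= b m <= (m ^ eta * ndiv m ^ j)%:R) ->
  forall l, (0 < l)%N ->
    0 <= dirichlet_conv A B a b l <= (l ^ eta * ndiv l ^ (i + j).+1)%:R.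
Proof.
move=> ha hb l l0; apply/andP; split.
  rewrite /dirichlet_conv big_nat; apply: sumr_ge0 => m /andP[m0 _].
  rewrite big_nat; apply: sumr_ge0 => n /andP[n0 _].
  by have /andP[? _] := ha m m0; have /andP[? _] := hb n n0; rewrite !mulr_ge0.
apply: le_trans (_ : \sum_(1 <= m < A.+1) \sum_(1 <= n < B.+1)
    (l == m * n)%N%:R * (l ^ eta * ndiv l ^ (i + j))%:R <= _); last first.
  rewrite expnS mulnCA [leRHS]natrM.
  under eq_bigr do rewrite -mulr_suml -natr_sum.
  rewrite -mulr_suml -natr_sum ler_wpM2r // ler_nat.
  apply: leq_trans (sum_dvdn_le_ndiv A.+1 l0).
  rewrite big_nat [leqRHS]big_nat; apply: leq_sum => m /andP[m0 _].
  exact: sum_eq_mul_le.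
rewrite /dirichlet_conv big_nat [leRHS]big_nat; apply: ler_sum => m /andP[m0 _].
rewrite big_nat [leRHS]big_nat; apply: ler_sum => n /andP[n0 _].
case: eqVneq => [lmn|_]; last by rewrite !mul0r.
rewrite !mul1r.
have /andP[a0 am] := ha m m0; have /andP[b0 bn] := hb n n0.
apply: le_trans (ler_pM a0 b0 am bn) _.
rewrite -natrM ler_nat mulnACA -expnMn -lmn leq_mul2l expnD.
rewrite leq_mul ?orbT //.
  by case: (i) => // i'; rewrite leq_exp2r // ndiv_dvd // lmn dvdn_mulr.
by case: (j) => // j'; rewrite leq_exp2r // ndiv_dvd // lmn dvdn_mull.
Qed.

(* The [l]-th coefficient of the fourth power of the sum of [n ^ eta * chi n]
   over [n <= k]. *)
Definition conv4_coef (T : pzRingType) (eta k : nat) : nat -> T :=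
  let a n := n%:R ^+ eta in
  let b := dirichlet_conv k k a a in
  dirichlet_conv (k * k) (k * k) b b.

Lemma conv4_coef_le (T : numDomainType) eta k l : (0 < l)%N ->
  0 <= conv4_coef T eta k l <= (l ^ eta * ndiv l ^ 3)%:R.
Proof.
move=> l0; apply: (@dirichlet_conv_le _ _ _ _ 1 1) => // {l0}l l0;
  apply: (@dirichlet_conv_le _ _ _ _ 0 0) => // {l0}l l0;
  by rewrite expn0 muln1 natrX lexx exprn_ge0.
Qed.

Lemma conv4_sum (T : comPzRingType) eta k (chi : nat -> T) :
  (forall m n, chi (m * n)%N = chi m * chi n) ->
  (\sum_(1 <= n < k.+1) n%:R ^+ eta * chi n) ^+ 4 =
  \sum_(1 <= l < (k ^ 4).+1) conv4_coef T eta k l * chi l.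
Proof.
move=> chiM; rewrite (exprM _ 2 2) [X in X ^+ 2]expr2 dirichlet_conv_sum //.
by rewrite expr2 dirichlet_conv_sum // !mulnn -expnM.
Qed.

(** Squaring the coefficient bound gives [ndiv l ^ 6], whose sum up to [k ^ 4] costs [k ^ 4] and 2^6
    = 64 harmonic sums; the factor [l ^ (2 * eta)] is at most [k ^ (8 * eta)]. *)
Lemma sum_conv4_coef_le (R : realType) eta k : (0 < k)%N ->
  \sum_(1 <= l < (k ^ 4).+1) `|conv4_coef R[i] eta k l| ^+ 2 <=
  ((k ^ (8 * eta + 4))%:R * harmonic_sum R (k ^ 4) ^+ 64)%:C%C.
Proof.
move=> k0; have k40 : (0 < k ^ 4)%N by rewrite expn_gt0 k0.
apply: le_trans (_ : \sum_(1 <= l < (k ^ 4).+1) ((k ^ (8 * eta))%:R * (ndiv l ^ 6)%:R) <= _).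
  rewrite big_nat [leRHS]big_nat; apply: ler_sum => l /andP[l0 lk].
  have /andP[c0 c1] := conv4_coef_le R[i] eta k l0.
  rewrite ger0_norm // -natrM.
  apply: le_trans (lerXn2r 2 _ _ c1) _; rewrite ?nnegrE //.
  rewrite -natrX ler_nat expnMn -!expnM leq_mul //.
  rewrite (_ : 8 * eta = 4 * (eta * 2))%N; last by lia.
  by rewrite (expnM k 4); case: (eta * 2)%N => // e; rewrite leq_exp2r // -ltnS.
rewrite -mulr_sumr expnD natrM -mulrA rmorphM /= rmorph_nat.
rewrite ler_pM2l ?ltr0n ?expn_gt0 ?k0 //.
have := sum_ndivX_le R 6 k40; rewrite -lecR => /(le_trans _); apply.
by rewrite rmorph_sum; under [leRHS]eq_bigr do rewrite rmorph_nat.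
Qed.

End DirichletConvolution.

(** * Dirichlet characters modulo a prime *)

Section Characters.
Variables (R : realType) (p : nat) (chi : int -> R[i]).
Hypothesis pp : prime p.

Section Dirichlet.
Hypothesis hchi : dirichlet_characters R p chi.

Lemma dirichlet_char1 : chi 1 = 1.
Proof.
have [cM _ c0] := hchi.
have h : chi 1 != 0 by rewrite c0 /coprimez gcd1z.
by apply: (mulfI h); rewrite -cM !mulr1.
Qed.

Lemma dirichlet_charM (m n : nat) : chi (m * n)%N%:Z = chi m%:Z * chi n%:Z.
Proof. by have [cM _ _] := hchi; rewrite PoszM cM. Qed.

Lemma dirichlet_char_addM (n : int) (k : nat) : chi (n + (k * p)%N%:Z) = chi n.
Proof.
have [_ cD _] := hchi.
elim: k => [|k IH]; first by rewrite mul0n addr0.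
by rewrite mulSn PoszD addrCA addrC cD.
Qed.

Lemma dirichlet_char_mod (n : nat) : chi (n %% p)%N%:Z = chi n%:Z.
Proof. by rewrite [in RHS](divn_eq n p) addnC PoszD dirichlet_char_addM. Qed.

Lemma dirichlet_charX (n k : nat) : chi (n ^ k)%N%:Z = chi n%:Z ^+ k.
Proof.
by elim: k => [|k IH]; rewrite ?expn0 ?dirichlet_char1 // expnS dirichlet_charM IH exprS.
Qed.

(** By Euler's theorem a nonzero value is a root of unity. *)
Lemma norm_dirichlet_char_le1 (n : nat) : `|chi n%:Z| <= 1.
Proof.
have [_ _ c0] := hchi.
have [->|cn] := eqVneq (chi n%:Z) 0; first by rewrite normr0 ler01.
have nc : coprime n p by move: cn; rewrite c0.
have t0 : (totient p != 0)%N by rewrite -lt0n totient_gt0 prime_gt0.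
suff : `|chi n%:Z| ^+ totient p == 1 by rewrite pexpr_eq1 ?lt0n // => /eqP ->.
rewrite -normrX -dirichlet_charX -dirichlet_char_mod cyclic.Euler_exp_totient //.
by rewrite dirichlet_char_mod dirichlet_char1 normr1.
Qed.
End Dirichlet.

(** Multiplication by some [n] coprime to [p] with [chi n != 1] permutes the residues, so the sum
    equals [chi n] times itself. Such an [n] exists, as otherwise [chi] would be the principal
    character. *)
Lemma sum_nonprincipal_char : nonprincipal_characters R p chi ->
  \sum_(h < p) chi (h : nat)%:Z = 0.
Proof.
move=> [hchi np]; have [cM cD c0] := hchi; have p0 := prime_gt0 pp.
have [n cn1 ncp] : exists2 n : nat, chi n%:Z != 1 & coprime n p.
  apply: contrapT => H; apply: np; apply/funext => z.
  pose n := `|(z %% p)%Z|%N.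
  have nE : n%:Z = (z %% p)%Z by rewrite gez0_abs // modz_ge0 // eqz_nat -lt0n.
  have chizn : chi z = chi n%:Z.
    rewrite nE [in LHS](divz_eq z p) addrC.
    case: (z %/ p)%Z => k; first by rewrite -PoszM dirichlet_char_addM.
    rewrite -(dirichlet_char_addM hchi _ k.+1) NegzE mulNr -PoszM subrK //.
  have czn : coprimez z p = coprime n p.
    by apply/idP/idP; rewrite -[coprime n p]/(coprimez n%:Z p) -!c0 chizn.
  rewrite /principal_character czn chizn.
  case: (boolP (coprime n p)) => ncp.
    by apply/eqP; apply: contrapT => /negP ne; apply: H; exists n.
  by apply/eqP; move: ncp; rewrite -[coprime n p]/(coprimez n%:Z p) -c0 negbK.
have e (h : 'I_p) : (n * h %% p < p)%N by rewrite ltn_mod.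
have inj : injective (fun h => Ordinal (e h)).
  have main (h h' : 'I_p) : (h <= h')%N -> n * h' = n * h %[mod p] -> h = h'.
    move=> hh /eqP; rewrite eqn_mod_dvd ?leq_mul // -mulnBr Gauss_dvdr; last first.
      by rewrite coprime_sym.
    have := ltn_ord h' => hp /dvdn_leq H; apply/val_inj => /=.
    by apply/eqP; rewrite eqn_leq hh /= leqNgt -subn_gt0; apply/negP => /H; lia.
  move=> h h' /(congr1 val) /= E.
  by case: (leqP h h') => [|/ltnW] hh; [|symmetry]; apply: main.
have cn0 : chi n%:Z - 1 != 0 by rewrite subr_eq0.
apply: (mulfI cn0); rewrite mulr0 mulrBl mul1r; apply/eqP; rewrite subr_eq0; apply/eqP.
rewrite [RHS](reindex_inj inj) mulr_sumr; apply: eq_bigr => h _ /=.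
by rewrite dirichlet_char_mod // dirichlet_charM.
Qed.
End Characters.

Section CharacterSums.
Variable R : realType.

Lemma normr_normc (z : R[i]) : `|z| = (normc z)%:C%C.
Proof. by rewrite normc_def; case: z. Qed.

Lemma normc_ge0 (z : R[i]) : 0 <= normc z.
Proof. by case: z => a b /=; rewrite sqrtr_ge0. Qed.

Variables (eta k : nat).
Hypothesis k0 : (0 < k)%N.

Definition char_sum (chi : int -> R[i]) : R[i] :=
  \sum_(1 <= n < k.+1) n%:R ^+ eta * chi n%:Z.

Let c (m : 'I_(k ^ 4).+1) : R[i] :=
  if (m == 0 :> nat)%N then 0 else conv4_coef R[i] eta k m.

(** A majorant of the eighth power of [char_sum] common to all nonprincipal characters modulo [p].
    Its sum over primes is the left side of the large sieve. *)
Definition farey_moment (p : nat) : R :=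
  \sum_(a < p | (0 < a)%N)
    normc (\sum_(m < (k ^ 4).+1) expi (a%:R / p%:R : R) ^+ m * c m) ^+ 2.

Lemma farey_moment_ge0 p : 0 <= farey_moment p.
Proof. by apply: sumr_ge0 => a _; rewrite exprn_ge0 // normc_ge0. Qed.

Lemma farey_momentE p : (farey_moment p)%:C%C = \sum_(a < p | (0 < a)%N)
    `|\sum_(m < (k ^ 4).+1) expi (a%:R / p%:R : R) ^+ m * c m| ^+ 2.
Proof.
rewrite /farey_moment rmorph_sum; apply: eq_bigr => a _.
by rewrite rmorphXn /= normr_normc.
Qed.

(** The eighth power is the square of the fourth, which [conv4_sum] turns into a linear character
    sum of length [k ^ 4]. *)
Lemma char_sum_le p chi : prime p -> nonprincipal_characters R p chi ->
  normc (char_sum chi) ^+ 8 <= farey_moment p.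
Proof.
move=> pp np; have [hchi _] := np.
rewrite -lecR farey_momentE.
have := @norm_char_sum_le R p (prime_gt0 pp) (fun n => chi n%:Z) _ c.
move=> H; apply: le_trans (H _ _ _) => {H}; last 3 first.
- by move=> n; exact: dirichlet_char_mod hchi n.
- by move=> n; exact: norm_dirichlet_char_le1 pp hchi n.
- exact: sum_nonprincipal_char.
have -> : \sum_(m < (k ^ 4).+1) c m * chi (m : nat)%:Z = char_sum chi ^+ 4.
  rewrite /char_sum (conv4_sum _ _ (dirichlet_charM hchi)).
  rewrite big_ord_recl /= /c eqxx mul0r add0r big_add1 big_mkord.
  by apply: eq_bigr => i _; rewrite lift0.
by rewrite normrX -exprM normr_normc rmorphXn.
Qed.

Lemma sum_farey_moment_le Y : (0 < Y)%N ->
  \sum_(0 <= p < Y.+1 | prime p) farey_moment p <=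
  ((k ^ 4).+1%:R + 6 * (Y ^ 2)%:R * harmonic_sum R (2 * Y ^ 2)) *
  ((k ^ (8 * eta + 4))%:R * harmonic_sum R (k ^ 4) ^+ 64).
Proof.
move=> Y0; rewrite -lecR rmorphM /=.
have := farey_large_sieve Y0 c.
have -> : \sum_(m < (k ^ 4).+1) `|c m| ^+ 2 =
   \sum_(1 <= l < (k ^ 4).+1) `|conv4_coef R[i] eta k l| ^+ 2.
  rewrite big_ord_recl /= {1}/c eqxx normr0 expr0n add0r big_add1 big_mkord.
  by apply: eq_bigr => i _; rewrite /c lift0.
have -> : (\sum_(0 <= p < Y.+1 | prime p) farey_moment p)%:C%C =
    \sum_(i | @farey_index Y i)
    `|\sum_(m < (k ^ 4).+1) expi (farey_point R i) ^+ m * c m| ^+ 2.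
  rewrite big_mkord rmorph_sum /=.
  rewrite -(pair_big_dep (fun p : 'I_Y.+1 => prime p)
    (fun (p a : 'I_Y.+1) => (0 < a < p)%N) (fun p a =>
    `|\sum_(m < (k ^ 4).+1) expi (a%:R / p%:R : R) ^+ m * c m| ^+ 2)) /=.
  apply: eq_bigr => p _; rewrite farey_momentE.
  rewrite (big_ord_widen_cond Y.+1 (fun a => 0 < a)%N (fun a : nat =>
    `|\sum_(m < (k ^ 4).+1) expi (a%:R / p%:R : R) ^+ m * c m| ^+ 2)) //.
  by rewrite ltnW.
move=> H; apply: le_trans H _; apply: ler_wpM2l.
  rewrite lecR addr_ge0 // !mulr_ge0 //; apply: sumr_ge0 => i _.
  by rewrite invr_ge0.
exact: sum_conv4_coef_le.
Qed.
End CharacterSums.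

(** * Decay of the Gaussian weights *)

Section ThetaPartial.
Variable R : realType.

Lemma expRN_le (x : R) (j : nat) : 0 < x -> (0 < j)%N ->
  expR (- x) <= (j%:R / x) ^+ j.
Proof.
move=> x0 j0; have jR : 0 < j%:R :> R by rewrite ltr0n.
have xj : 0 < x / j%:R by rewrite divr_gt0.
have h : (x / j%:R) ^+ j <= expR x.
  rewrite -[in leRHS](divfK (lt0r_neq0 jR) x) expRM_natr.
  apply: lerXn2r; rewrite ?nnegrE ?expR_ge0 ?(ltW xj) //.
  by apply: le_trans (expR_ge1Dx _); rewrite lerDr.
by rewrite expRN -invf_div exprVn lef_pV2 ?posrE ?expR_gt0 ?exprn_gt0.
Qed.

Variables (p : nat).
Hypothesis p0 : (0 < p)%N.

(** The factor 1 is the argument [x = 1] of [Theta], kept so that partial sums agree with its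
    definition literally. *)
Definition gauss_weight (n : nat) : R := expR (- (pi * n%:R ^+ 2 * 1 / p%:R)).

(* The exponent 18 is large enough for the tail [k >= Y] to converge under the
   trivial bound [|S k| <= k ^ 2]; 9 bounds [18 / pi]. *)
Lemma gauss_weight_le n j : (0 < n)%N -> (0 < j <= 18)%N ->
  gauss_weight n <= (9 * p%:R / n%:R ^+ 2) ^+ j.
Proof.
move=> n0 /andP[j0 j18]; have pR : 0 < p%:R :> R by rewrite ltr0n.
have nR : 0 < n%:R :> R by rewrite ltr0n.
have p2 := pi_ge2 R; have pi0 := pi_gt0 R.
apply: le_trans (expRN_le _ j0) _.
  by rewrite mulr1 divr_gt0 // mulr_gt0 // exprn_gt0.
have jR : j%:R <= 18 :> R by rewrite ler_nat.
apply: lerXn2r; rewrite ?nnegrE ?mulr1.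
- by rewrite divr_ge0 // divr_ge0 ?mulr_ge0 ?exprn_ge0 // ltW.
- by rewrite divr_ge0 ?mulr_ge0 ?exprn_ge0 // ltW.
have -> : j%:R / (pi * n%:R ^+ 2 / p%:R) = j%:R / pi * (p%:R / n%:R ^+ 2) :> R.
  by move: pi0; move: (pi : R) => P P0; field; rewrite !gt_eqF.
rewrite -[leRHS]mulrA ler_wpM2r //.
by rewrite ler_pdivrMr //; lra.
Qed.

(** Consecutive weights have ratio [expR (- d)] with [d = pi * (2 * n + 1) / p], and
    [1 - expR (- d) <= d]. The 12 comes from [pi <= 4] and [2 * n + 1 <= 3 * n]. *)
Lemma gauss_weightB_le n : (0 < n)%N ->
  0 <= gauss_weight n - gauss_weight n.+1 <= 12 * n%:R / p%:R * gauss_weight n.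
Proof.
move=> n0; have pR : 0 < p%:R :> R by rewrite ltr0n.
have n1 : 1 <= n%:R :> R by rewrite ler1n.
have p4 : pi <= 4 :> R by have := @pihalf_lt2 R; lra.
have pi0 := pi_gt0 R.
pose d : R := pi * (2 * n%:R + 1) / p%:R.
have d0 : 0 <= d.
  by rewrite divr_ge0 ?ler0n // mulr_ge0 ?(ltW pi0) // addr_ge0 ?mulr_ge0 ?ler0n.
have f0 : 0 <= gauss_weight n := expR_ge0 _.
have -> : gauss_weight n.+1 = gauss_weight n * expR (- d).
  rewrite /gauss_weight -expRD; congr expR; rewrite -natr1 /d.
  by move: (pi : R) => P; field; rewrite gt_eqF.
have -> : gauss_weight n - gauss_weight n * expR (- d) =
  (1 - expR (- d)) * gauss_weight n by ring.
apply/andP; split.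
  by rewrite mulr_ge0 // subr_ge0 expR_le1 oppr_le0.
rewrite ler_wpM2r //.
apply: (@le_trans _ _ d); first by have := expR_ge1Dx (- d); lra.
rewrite /d ler_wpM2r ?invr_ge0 ?(ltW pR) //; nra.
Qed.

End ThetaPartial.

(** * From theta series to character sums *)

Section Jensen.
Variables (R : realType) (m n : nat) (w : nat -> R).
Hypothesis w0 : forall i, 0 <= w i.
Hypothesis w1 : \sum_(m <= i < n) w i <= 1.

(** Expand the nonnegative weighted sum of [(s i - mu) ^+ 2], where [mu] is the weighted sum of the
    [s i]; total mass at most 1 suffices. *)
Lemma sqr_weighted_sum_le (s : nat -> R) :
  (\sum_(m <= i < n) w i * s i) ^+ 2 <= \sum_(m <= i < n) w i * s i ^+ 2.
Proof.
have [mu muE] : exists mu, \sum_(m <= i < n) w i * s i = mu by eexists.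
have : 0 <= \sum_(m <= i < n) w i * (s i - mu) ^+ 2.
  by apply: sumr_ge0 => i _; rewrite mulr_ge0 // sqr_ge0.
have -> : \sum_(m <= i < n) w i * (s i - mu) ^+ 2 =
    \sum_(m <= i < n) w i * s i ^+ 2 - 2 * mu * (\sum_(m <= i < n) w i * s i) + mu ^+ 2 * \sum_(m <= i < n) w i.
  rewrite !mulr_sumr -sumrB -big_split /=; apply: eq_bigr => i _; ring.
rewrite muE; have := sqr_ge0 mu; move: w1; nra.
Qed.
End Jensen.

Lemma weighted_sum_pow8_le (R : realType) (m n : nat) (w s : nat -> R) :
  (forall i, 0 <= w i) -> \sum_(m <= i < n) w i <= 1 -> (forall i, 0 <= s i) ->
  (\sum_(m <= i < n) w i * s i) ^+ 8 <= \sum_(m <= i < n) w i * s i ^+ 8.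
Proof.
move=> w0 w1 s0.
have ge0 j : 0 <= \sum_(m <= i < n) w i * s i ^+ j.
  by apply: sumr_ge0 => i _; rewrite mulr_ge0 // exprn_ge0.
have step j : (\sum_(m <= i < n) w i * s i ^+ j) ^+ 2 <=
    \sum_(m <= i < n) w i * s i ^+ (j * 2).
  apply: le_trans (sqr_weighted_sum_le w0 w1 (fun i => s i ^+ j)) _.
  by under eq_bigr do rewrite -exprM.
have mono (a b : R) : 0 <= a -> a <= b -> a ^+ 2 <= b ^+ 2.
  by move=> a0 ab; apply: lerXn2r; rewrite ?nnegrE ?(le_trans a0 ab).
have h1 := sqr_weighted_sum_le w0 w1 s.
have h2 := le_trans (mono _ _ (sqr_ge0 _) h1) (step 2%N).
have h4 := le_trans (mono _ _ (sqr_ge0 _) h2) (step 4%N).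
by move: h4; rewrite -!exprM.
Qed.

Section ThetaBound.
Variables (R : realType) (eta p : nat) (chi : int -> R[i]).
Hypothesis p0 : (0 < p)%N.

Definition theta_partial (M : nat) : R[i] :=
  \sum_(1 <= n < M.+1) chi n%:Z * n%:R ^+ eta * (gauss_weight R p n)%:C%C.

Let f := gauss_weight R p.
Let S k := char_sum eta k chi.

(* The boundary term of the Abel summation is the weight at [k = M]. *)
Definition abel_weight (M k : nat) : R := f k - (k < M)%N%:R * f k.+1.

Lemma abel_weight_ge0 M k : 0 <= abel_weight M k.
Proof.
have f0 i : 0 <= f i := expR_ge0 _.
rewrite /abel_weight; case: (k < M)%N; rewrite ?mul0r ?subr0 // mul1r subr_ge0.
rewrite /f /gauss_weight ler_expR lerN2 ler_pM2r ?invr_gt0 ?ltr0n // !mulr1.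
rewrite ler_pM2l ?pi_gt0 //; apply: lerXn2r; rewrite ?nnegrE ?ler0n //.
by rewrite ler_nat.
Qed.

Lemma sum_abel_weight M : \sum_(1 <= k < M.+2) abel_weight M.+1 k = f 1.
Proof.
rewrite big_nat_recr //= /abel_weight ltnn mul0r subr0.
rewrite [X in X + _](_ : _ = \sum_(1 <= k < M.+1) (f k - f k.+1)); last first.
  by apply: eq_big_nat => k /andP[_ kM]; rewrite kM mul1r.
have -> : \sum_(1 <= k < M.+1) (f k - f k.+1) =
    - \sum_(1 <= k < M.+1) (f k.+1 - f k).
  by rewrite -sumrN; under [RHS]eq_bigr do rewrite opprB.
by rewrite telescope_sumr //; ring.
Qed.

Lemma char_sumS k : S k.+1 = S k + k.+1%:R ^+ eta * chi k.+1%:Z.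
Proof. by rewrite /S /char_sum big_nat_recr. Qed.

Lemma theta_partial_abel M : theta_partial M.+1 =
  \sum_(1 <= k < M.+2) (abel_weight M.+1 k)%:C%C * S k.
Proof.
elim: M => [|M IH].
  rewrite /theta_partial !big_nat1 /abel_weight ltnn mul0r subr0 /S /char_sum.
  by rewrite big_nat1 -/f; ring.
rewrite /theta_partial big_nat_recr //= -/(theta_partial M.+1) IH.
rewrite [RHS]big_nat_recr //= [X in _ = X + _]big_nat_recr //=.
rewrite [X in X + _ = _]big_nat_recr //= (char_sumS M.+1) -/f.
(* Passing to [M.+2] leaves the weights at [k <= M] unchanged: only the old boundary weight at
   [M.+1] loses its successor. *)
rewrite [X in _ = X + _ + _](_ : _ =
    \sum_(1 <= k < M.+1) (abel_weight M.+1 k)%:C%C * S k); last first.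
  apply: eq_big_nat => k /andP[_ kM].
  by rewrite /abel_weight kM (ltnW kM : k < M.+2)%N.
rewrite /abel_weight !ltnn !mul0r !subr0 ltnSn mul1r rmorphB /=; ring.
Qed.

Lemma normc_sum_le (T : Type) (r : seq T) (F : T -> R[i]) :
  normc (\sum_(i <- r) F i) <= \sum_(i <- r) normc (F i).
Proof.
rewrite -lecR -normr_normc rmorph_sum; apply: le_trans (ler_norm_sum _ _ _) _.
by under eq_bigr do rewrite normr_normc.
Qed.

Lemma theta_partial_pow8_le M : normc (theta_partial M.+1) ^+ 8 <=
  \sum_(1 <= k < M.+2) abel_weight M.+1 k * normc (S k) ^+ 8.
Proof.
have w0 := abel_weight_ge0 M.+1.
apply: le_trans (weighted_sum_pow8_le w0 _ _); last 2 first.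
- by rewrite sum_abel_weight expR_le1 oppr_le0 divr_ge0 // !mulr_ge0 ?pi_ge0.
- by move=> i; exact: normc_ge0.
apply: lerXn2r; rewrite ?nnegrE ?normc_ge0 //.
  by apply: sumr_ge0 => i _; rewrite mulr_ge0 // normc_ge0.
rewrite theta_partial_abel; apply: le_trans (normc_sum_le _ _) _.
apply: ler_sum => k _; rewrite normcM.
by have -> : normc (abel_weight M.+1 k)%:C%C = abel_weight M.+1 k
  by rewrite /= expr0n addr0 sqrtr_sqr ger0_norm.
Qed.

End ThetaBound.

Section Limits.
Variable R : realType.

Lemma normc_lim_pow8_le (u : nat -> R[i]) (B : R) (M : nat) : 0 <= B ->
  (forall n, (M <= n)%N -> normc (u n) ^+ 8 <= B) ->
  normc (lim ((u n : R[i]^o) @[n --> \oo])) ^+ 8 <= B.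
Proof.
move=> B0 uB.
(* The eighth root of [B], so that the limit can be taken on moduli. *)
pose b := Num.sqrt (Num.sqrt (Num.sqrt B)).
have b0 : 0 <= b by rewrite sqrtr_ge0.
have b8 : b ^+ 8 = B.
  by rewrite /b (exprM _ 2 4) sqr_sqrtr ?sqrtr_ge0 // (exprM _ 2 2)
    sqr_sqrtr ?sqrtr_ge0 // sqr_sqrtr.
(* For a divergent sequence [lim] is the default value 0, and [0 <= B] concludes. *)
case: (pselect (cvg ((u n : R[i]^o) @[n --> \oo]))) => [cu|/dvgP ->]; last first.
  by change (normc (0 : R[i]) ^+ 8 <= B); rewrite normc0 expr0n.
rewrite -b8; apply: lerXn2r; rewrite ?nnegrE ?normc_ge0 //.
apply/ler_addgt0Pr => e e0.
have /cvgrPdist_lt/(_ e%:C%C) := cu; rewrite ltcR => /(_ e0)[N _ HN].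
set l := lim _.
have := HN (maxn M N) (leq_maxr _ _); rewrite /= -/l normr_normc ltcR => /ltW le1.
have le2 : normc (u (maxn M N)) <= b.
  rewrite leNgt; apply/negP => bu.
  have := uB _ (leq_maxl M N); rewrite -b8 leNgt => /negP; apply.
  by apply: ltrXn2r.
have -> : l = (l - u (maxn M N)) + u (maxn M N) by rewrite subrK.
apply: le_trans (le_normcD _ _) _; rewrite addrC; exact: lerD.
Qed.

(** The hypothesis [0 <= B] covers the default value 0 of [maximum], as happens for [p = 2]. *)
Lemma max_Theta8_le (p eta : nat) (B : R) : 0 <= B ->
  (forall chi, nonprincipal_characters R p chi ->
    normc (Theta p eta 1 chi) ^+ 8 <= B) ->
  max_Theta8 R p eta <= B.
Proof.
move=> B0 H; rewrite /max_Theta8 /maximum; case: xgetP => [y _ [[chi np <-] _]|_ //].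
exact: H.
Qed.
End Limits.

Section Weights.
Variable R : realType.

(** The 12 of [gauss_weightB_le] times the 9 of [gauss_weight_le] at its largest exponent 18. *)
Definition weight_const : R := 12 * 9 ^+ 18.

Lemma weight_const_gt0 : 0 < weight_const.
Proof. by rewrite mulr_gt0 // exprn_gt0. Qed.

(** One of the [j.+1] factors [p / k ^ 2] bounding the Gaussian is spent on the [k / p] of its
    decrement, leaving [1 / k]. *)
Lemma abel_weight_le p M k j : (0 < p)%N -> (0 < k < M)%N -> (j <= 17)%N ->
  abel_weight R p M k <= weight_const / k%:R * (p%:R / k%:R ^+ 2) ^+ j.
Proof.
move=> p0 /andP[k0 kM] j17.
have pR : 0 < p%:R :> R by rewrite ltr0n.
have kR : 0 < k%:R :> R by rewrite ltr0n.
rewrite /abel_weight kM mul1r.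
have /andP[_ h] := @gauss_weightB_le R p p0 k k0.
apply: (le_trans h).
have h2 := @gauss_weight_le R p p0 k j.+1 k0 j17.
have q0 : 0 <= 12 * k%:R / p%:R :> R by rewrite divr_ge0 ?mulr_ge0 // ltW.
apply: le_trans (ler_wpM2l q0 h2) _.
have -> : 9 * p%:R / k%:R ^+ 2 = 9 * (p%:R / k%:R ^+ 2) :> R by rewrite mulrA.
set t := p%:R / k%:R ^+ 2.
have tE : k%:R / p%:R * t = k%:R^-1 by rewrite /t; field; rewrite !gt_eqF.
have -> : 12 * k%:R / p%:R * (9 * t) ^+ j.+1 = 12 * 9 ^+ j.+1 / k%:R * t ^+ j.
  by rewrite -tE exprMn (exprS t); ring.
have t0 : 0 <= t by rewrite divr_ge0 ?exprn_ge0 // ltW.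
rewrite ler_wpM2r ?exprn_ge0 // ler_wpM2r ?invr_ge0 ?(ltW kR) //.
by rewrite /weight_const ler_wpM2l // ler_weXn2l // ler1n.
Qed.

(* Majorizes the Gaussian decrements at [k], up to [weight_const / k], uniformly
   in [p <= Y]. *)
Definition cutoff (Y k : nat) : R :=
  if (k ^ 2 <= Y)%N then 1 else (Y%:R / k%:R ^+ 2) ^+ 17.

Lemma abel_weight_cutoff p Y M k : (0 < p <= Y)%N -> (0 < k < M)%N ->
  abel_weight R p M k <= weight_const / k%:R * cutoff Y k.
Proof.
move=> /andP[p0 pY] kM; have /andP[k0 _] := kM.
have kR : 0 < k%:R :> R by rewrite ltr0n.
rewrite /cutoff; case: ifP => _.
  by have := abel_weight_le p0 kM (leq0n 17); rewrite expr0.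
apply: le_trans (abel_weight_le p0 kM (leqnn 17)) _.
rewrite ler_wpM2l //; first by rewrite divr_ge0 ?(ltW kR) // ltW // weight_const_gt0.
apply: lerXn2r; rewrite ?nnegrE ?divr_ge0 ?exprn_ge0 //.
by rewrite ler_pM2r ?invr_gt0 ?exprn_gt0 // ler_nat.
Qed.

Lemma normc_char_sum_le eta p k chi : (eta <= 1)%N -> prime p ->
  dirichlet_characters R p chi -> normc (char_sum eta k chi) <= k%:R ^+ 2.
Proof.
move=> eta1 pp hchi; rewrite -lecR -normr_normc.
apply: le_trans (ler_norm_sum _ _ _) _.
apply: le_trans (_ : \sum_(1 <= n < k.+1) k%:R <= _).
  rewrite big_nat [leRHS]big_nat; apply: ler_sum => n /andP[n0 nk].
  rewrite normrM normrX normr_nat -[leRHS]mulr1.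
  apply: ler_pM => //; last exact: norm_dirichlet_char_le1 pp hchi n.
  rewrite -natrX ler_nat; apply: leq_trans (_ : n ^ 1 <= k)%N; last by rewrite expn1.
  by rewrite leq_pexp2l.
by rewrite sumr_const_nat subn1 -(mulr_natr k%:R) -expr2 rmorphXn /= rmorph_nat.
Qed.

Lemma abel_tail_le eta p Y M k chi : (eta <= 1)%N -> prime p -> (p <= Y)%N ->
  dirichlet_characters R p chi -> (Y <= k <= M)%N ->
  abel_weight R p M k * normc (char_sum eta k chi) ^+ 8 <=
  weight_const / k%:R ^+ 2.
Proof.
move=> eta1 pp pY hchi /andP[Yk kM]; have p0 := prime_gt0 pp.
have k0 : (0 < k)%N by apply: leq_trans Yk; exact: leq_trans pY.
have kR : 0 < k%:R :> R by rewrite ltr0n.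
have pk : p%:R / k%:R ^+ 2 <= k%:R^-1 :> R.
  rewrite expr2 invfM mulrA ler_piMl ?invr_ge0 ?(ltW kR) //.
  by rewrite ler_pdivrMr // mul1r ler_nat (leq_trans pY).
have pk0 : 0 <= p%:R / k%:R ^+ 2 :> R by rewrite divr_ge0 ?exprn_ge0.
(* Since [p <= k], the ratio [p / k ^ 2] is at most [1 / k]. Its 18 powers beat the [k ^ 16] of the
   trivial bound by [k ^ 2]. *)
have wk : abel_weight R p M k <= weight_const * k%:R^-1 ^+ 18.
  have W0 := weight_const_gt0.
  case: (ltngtP k M) kM => // [kM _|kM _].
    have kM' : (0 < k < M)%N by rewrite k0.
    apply: le_trans (abel_weight_le p0 kM' (leqnn 17)) _.
    rewrite [in leRHS]exprS [leRHS]mulrA ler_wpM2l ?divr_ge0 ?(ltW kR) ?(ltW W0) //.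
    by apply: lerXn2r; rewrite ?nnegrE ?invr_ge0 ?(ltW kR).
  (* At the boundary the weight is the Gaussian itself, so all 18 powers come from it directly. *)
  rewrite /abel_weight -kM ltnn mul0r subr0.
  apply: le_trans (@gauss_weight_le R p p0 k 18 k0 isT) _.
  rewrite -mulrA exprMn; apply: ler_pM; rewrite ?exprn_ge0 //.
    by rewrite /weight_const ler_peMl ?exprn_ge0 // ler1n.
  by apply: lerXn2r; rewrite ?nnegrE ?invr_ge0 ?(ltW kR).
have s8 : normc (char_sum eta k chi) ^+ 8 <= k%:R ^+ 16.
  rewrite (exprM _ 2 8); apply: lerXn2r; rewrite ?nnegrE ?normc_ge0 ?exprn_ge0 //.
  exact: normc_char_sum_le pp hchi.
apply: (@le_trans _ _ (weight_const * k%:R^-1 ^+ 18 * k%:R ^+ 16)).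
  by apply: ler_pM => //; [exact: abel_weight_ge0 | rewrite exprn_ge0 // normc_ge0].
rewrite -mulrA ler_wpM2l ?(ltW weight_const_gt0) //.
by rewrite (exprD _ 2 16) -mulrA -exprMn mulVf ?gt_eqF // expr1n mulr1 exprVn.
Qed.

Lemma sum_inv_sqr_le n : \sum_(1 <= k < n.+1) (k%:R ^+ 2)^-1 <= 2 :> R.
Proof.
(* The bound is strengthened by [1 / m.+1] to make the induction go through. *)
suff H m : \sum_(1 <= k < m.+2) (k%:R ^+ 2)^-1 <= 2 - m.+1%:R^-1 :> R.
  case: n => [|n]; first by rewrite big_geq.
  by apply: le_trans (H n) _; rewrite gerBl invr_ge0.
elim: m => [|i IH]; first by rewrite big_nat1 expr1n invr1; lra.
rewrite big_nat_recr //=; apply: le_trans (lerD IH (lexx _)) _.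
have nR : 0 < i.+1%:R :> R by rewrite ltr0n.
rewrite -(natr1 i.+1); set x := i.+1%:R in nR *.
have -> : 2 - x^-1 + ((x + 1) ^+ 2)^-1 = 2 - (x + 1)^-1 - (x * (x + 1) ^+ 2)^-1.
  by field; rewrite !gt_eqF // ltr_wpDr.
by rewrite lerBlDr lerDl invr_ge0 mulr_ge0 ?exprn_ge0 ?(ltW nR) // addr_ge0 // ltW.
Qed.

End Weights.

(** * Summation over primes up to [Y] *)

Section FixedLength.
Variables (R : realType) (eta : nat).
Hypothesis eta1 : (eta <= 1)%N.

Let K := weight_const R.

(** A majorant of [|Theta|^8] independent of the character. The terms [k >= Y] give [2 * K], as
    inverse squares sum to at most 2. *)
Definition theta8_bound (Y p : nat) : R :=
  \sum_(1 <= k < Y) K / k%:R * cutoff R Y k * farey_moment R eta k p + 2 * K.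

Lemma theta_partial_bound p Y M chi : prime p -> (p <= Y <= M.+1)%N ->
  nonprincipal_characters R p chi ->
  normc (theta_partial eta p chi M.+1) ^+ 8 <= theta8_bound Y p.
Proof.
move=> pp /andP[pY YM] np; have [hchi _] := np; have p0 := prime_gt0 pp.
have Y0 : (0 < Y)%N := leq_trans p0 pY.
apply: le_trans (theta_partial_pow8_le eta chi p0 M) _.
(* As [Y <= M.+1], the boundary index [M.+1] falls in the tail, and all [k < Y] carry genuine
   decrements. *)
rewrite (@big_cat_nat _ _ _ Y) //=; last by rewrite ltnW // ltnS.
apply: lerD.
  rewrite big_nat [leRHS]big_nat; apply: ler_sum => k /andP[k0 kY].
  apply: ler_pM.
  - exact: abel_weight_ge0.
  - by rewrite exprn_ge0 // normc_ge0.
  - by apply: abel_weight_cutoff; rewrite ?p0 // k0 (leq_trans kY).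
  - exact: char_sum_le.
apply: (@le_trans _ _ (\sum_(Y <= k < M.+2) K / k%:R ^+ 2)).
  rewrite big_nat [leRHS]big_nat; apply: ler_sum => k /andP[Yk kM].
  by apply: (abel_tail_le (Y := Y)) => //; rewrite Yk.
rewrite -mulr_sumr mulrC ler_wpM2r ?(ltW (weight_const_gt0 R)) //.
apply: le_trans (sum_inv_sqr_le R M.+1).
rewrite [leRHS](@big_cat_nat _ _ _ Y) //=; last by rewrite ltnW // ltnS.
by rewrite lerDr; apply: sumr_ge0 => k _; rewrite invr_ge0 exprn_ge0.
Qed.

Lemma cutoff_ge0 Y k : 0 <= cutoff R Y k.
Proof. by rewrite /cutoff; case: ifP => // _; rewrite exprn_ge0 // divr_ge0 ?exprn_ge0. Qed.

Lemma theta8_bound_ge0 Y p : 0 <= theta8_bound Y p.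
Proof.
have W0 := ltW (weight_const_gt0 R).
apply: addr_ge0; last by rewrite mulr_ge0.
apply: sumr_ge0 => k _.
by rewrite !mulr_ge0 ?invr_ge0 ?cutoff_ge0 ?farey_moment_ge0.
Qed.

Lemma max_Theta8_bound p Y : prime p -> (p <= Y)%N ->
  max_Theta8 R p eta <= theta8_bound Y p.
Proof.
move=> pp pY; apply: max_Theta8_le; first exact: theta8_bound_ge0.
move=> chi np; apply: (normc_lim_pow8_le (M := Y)); first exact: theta8_bound_ge0.
case=> [|n] Yn.
  by move: (leq_trans (prime_gt0 pp) (leq_trans pY Yn)).
by apply: theta_partial_bound => //; rewrite pY.
Qed.

(** With [t = k ^ 2] the second factor is [(t ^ 2 + Y ^ 2) * t ^ (4 * eta + 2)], at most twice the
    power [4 * eta + 4] of the larger of [t] and [Y]. For [t > Y], that many of the 17 factors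
    [Y / t] turn [t] back into [Y]. *)
Lemma cutoff_moment_le Y k : (0 < k)%N ->
  cutoff R Y k * (((k ^ 4)%:R + (Y ^ 2)%:R) * (k ^ (8 * eta + 4))%:R) <=
  2 * Y%:R ^+ (4 * eta + 4).
Proof.
move=> k0; have kR : 0 < k%:R :> R by rewrite ltr0n.
rewrite (_ : 8 * eta + 4 = 2 * (4 * eta + 2))%N; last by lia.
rewrite (expnM k 2 2) (expnM k 2 (_ + _)).
rewrite /cutoff; set t := (k ^ 2)%N; case: ifP => [tY|/negbT].
  rewrite mul1r -natrD -natrM -natrX -[2 * _]natrM ler_nat.
  apply: leq_trans (_ : (Y ^ 2 + Y ^ 2) * Y ^ (4 * eta + 2) <= _)%N.
    by rewrite leq_mul ?leq_add2r ?leq_exp2r // ?addnS.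
  by rewrite addnn -mul2n -mulnA -expnD (_ : 2 + (4 * eta + 2) = 4 * eta + 4)%N //; lia.
rewrite -ltnNge => Yt; rewrite -natrX -/t.
have tR : 0 < t%:R :> R by rewrite ltr0n expn_gt0 k0.
set x := Y%:R / t%:R.
have x0 : 0 <= x by rewrite divr_ge0 // ltW.
have x1 : x <= 1 by rewrite ler_pdivrMr // mul1r ler_nat ltnW.
have -> : Y%:R = x * t%:R :> R by rewrite divfK // gt_eqF.
have -> : (17 = (4 * eta + 4) + (13 - 4 * eta))%N by move: eta1; lia.
rewrite exprD.
apply: (@le_trans _ _ (x ^+ (4 * eta + 4) * 1 * (2 * t%:R ^+ (4 * eta + 4)))).
  apply: ler_pM; rewrite ?mulr_ge0 ?exprn_ge0 ?addr_ge0 //.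
    by rewrite ler_wpM2l ?exprn_ge0 // exprn_ile1.
  rewrite -natrX -[2 * _]natrM -natrD -natrM ler_nat.
  apply: leq_trans (_ : (t ^ 2 + t ^ 2) * t ^ (4 * eta + 2) <= _)%N.
    by rewrite leq_mul // leq_add2l leq_exp2r // ltnW.
  by rewrite addnn -mul2n -mulnA -expnD (_ : 2 + (4 * eta + 2) = 4 * eta + 4)%N //; lia.
by rewrite mulr1 mulrCA -exprMn.
Qed.

Lemma sum_max_Theta8_le Y : (0 < Y)%N ->
  \sum_(0 <= p < Y.+1 | prime p) max_Theta8 R p eta <=
  20 * K * (Y%:R ^+ (4 * eta + 4) * harmonic_sum R (2 * Y ^ 4) ^+ 66).
Proof.
move=> Y0; have K0 := weight_const_gt0 R.
(* One harmonic sum dominating all those that occur. Of the 66 powers, 64 come from divisor moments,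
   one from the large sieve and one from summing [1 / k]. *)
set L := harmonic_sum R (2 * Y ^ 4).
have L1 : 1 <= L by apply: harmonic_sum_ge1; rewrite muln_gt0 expn_gt0 Y0.
have Lge n : (n <= 2 * Y ^ 4)%N -> harmonic_sum R n <= L by exact: harmonic_sum_le.
have L0 : 0 <= L by exact: le_trans L1.
have YR : 1 <= Y%:R :> R by rewrite ler1n.
have H0 n : 0 <= harmonic_sum R n by apply: sumr_ge0 => i _; rewrite invr_ge0.
apply: (@le_trans _ _ (\sum_(0 <= p < Y.+1 | prime p) theta8_bound Y p)).
  rewrite big_nat_cond [leRHS]big_nat_cond; apply: ler_sum => p /andP[/andP[_ pY] pp].
  exact: max_Theta8_bound.
rewrite /theta8_bound big_split /=.
(* The 16 is for [k < Y], as 8 from the large sieve factor times 2 from [cutoff_moment_le]; the 4 is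
   for the tail, [2 * K] at each of at most [Y + 1 <= 2 * Y] primes. *)
have -> : 20 * K * (Y%:R ^+ (4 * eta + 4) * L ^+ 66) =
  16 * K * (Y%:R ^+ (4 * eta + 4) * L ^+ 66) +
  4 * K * (Y%:R ^+ (4 * eta + 4) * L ^+ 66) by ring.
apply: lerD; last first.
  rewrite big_mkcond /=.
  apply: (@le_trans _ _ (\sum_(0 <= p < Y.+1) 2 * K)).
    by apply: ler_sum => p _; case: ifP => // _; rewrite mulr_ge0 // ltW.
  rewrite sumr_const_nat subn0 -[leLHS]mulr_natr.
  rewrite (_ : 4 * K * _ = 2 * K * (2 * (Y%:R ^+ (4 * eta + 4) * L ^+ 66))); last by ring.
  rewrite ler_wpM2l ?mulr_ge0 ?(ltW K0) //.
  apply: (@le_trans _ _ (2 * Y%:R)).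
    by rewrite -natr1; lra.
  rewrite ler_wpM2l // -[leLHS]mulr1; apply: ler_pM => //.
    by rewrite addnS exprS ler_peMr // exprn_ege1.
  exact: exprn_ege1.
rewrite exchange_big /=.
apply: (@le_trans _ _ (\sum_(1 <= k < Y) k%:R^-1 *
    (16 * K * (Y%:R ^+ (4 * eta + 4) * L ^+ 65)))); last first.
  rewrite -mulr_suml (exprS L 65).
  rewrite (_ : 16 * K * (_ * (L * _)) = L * (16 * K * (Y%:R ^+ (4 * eta + 4) * L ^+ 65)));
    last by ring.
  rewrite ler_wpM2r //; first by rewrite !mulr_ge0 ?exprn_ge0 ?(ltW K0).
  apply: le_trans (Lge Y.-1 _).
    by rewrite /harmonic_sum prednK.
  apply: leq_trans (leq_pred _) _; rewrite -[leqLHS]mul1n leq_mul //.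
  by rewrite -[leqLHS]expn1 leq_pexp2l.
rewrite big_nat [leRHS]big_nat; apply: ler_sum => k /andP[k0 kY].
rewrite -mulr_sumr.
have c0 := cutoff_ge0 Y k.
have kR : 0 < k%:R :> R by rewrite ltr0n.
apply: le_trans (ler_wpM2l _ (sum_farey_moment_le R eta k0 Y0)) _.
  by rewrite !mulr_ge0 ?invr_ge0 ?(ltW K0).
apply: (@le_trans _ _ (K / k%:R * cutoff R Y k *
   ((8 * ((k ^ 4)%:R + (Y ^ 2)%:R) * L) * ((k ^ (8 * eta + 4))%:R * L ^+ 64)))).
  rewrite ler_wpM2l ?mulr_ge0 ?invr_ge0 ?(ltW K0) //.
  apply: ler_pM; rewrite ?mulr_ge0 ?addr_ge0 ?mulr_ge0 ?exprn_ge0 //.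
    have k41 : 1 <= (k ^ 4)%:R :> R by rewrite ler1n expn_gt0 k0.
    have Y20 : 0 <= (Y ^ 2)%:R :> R by [].
    have HL : harmonic_sum R (2 * Y ^ 2) <= L.
      by apply: Lge; rewrite leq_mul2l leq_pexp2l.
    by rewrite -natr1; nra.
  rewrite ler_wpM2l //; apply: lerXn2r; rewrite ?nnegrE //.
  apply: Lge; apply: leq_trans (_ : Y ^ 4 <= _)%N; first by rewrite leq_exp2r // ltnW.
  by rewrite leq_pmull.
have := cutoff_moment_le Y k0; set Q := cutoff R Y k * _ => hQ.
rewrite [leLHS](_ : _ = k%:R^-1 * (8 * K * (Q * L ^+ 65))); last first.
  by rewrite /Q (exprS L 64); ring.
rewrite ler_wpM2l ?invr_ge0 ?(ltW kR) //.
rewrite [leRHS](_ : _ = 8 * K * ((2 * Y%:R ^+ (4 * eta + 4)) * L ^+ 65)); last by ring.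
by rewrite ler_wpM2l ?mulr_ge0 ?(ltW K0) // ler_wpM2r // exprn_ge0.
Qed.
End FixedLength.

(** * Asymptotics *)

Section Asymptotics.
Variable R : realType.

Lemma harmonic_sum_le_ln N : (0 < N)%N -> harmonic_sum R N <= 1 + ln N%:R.
Proof.
case: N => // N _; elim: N => [|N IH].
  by rewrite /harmonic_sum big_nat1 invr1 ln1 addr0.
rewrite /harmonic_sum big_nat_recr //=; apply: le_trans (lerD IH (lexx _)) _.
have x0 : 0 < N.+1%:R :> R by rewrite ltr0n.
have y0 : 0 < N.+2%:R :> R by rewrite ltr0n.
rewrite -addrA lerD2l -lerBrDl -lerN2 opprB.
have -> : ln N.+1%:R - ln N.+2%:R = ln (1 + - N.+2%:R^-1) :> R.
  rewrite -ln_div ?posrE //; congr ln.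
  by rewrite -(natr1 N.+1); field; rewrite gt_eqF // ltr_wpDr.
by apply: le_ln1Dx; rewrite ltrN2 invf_lt1 // ltr1n.
Qed.

Lemma ln_le_id (x : R) : 0 < x -> ln x <= x.
Proof.
move=> x0; apply: (@le_trans _ _ (x - 1)); last by rewrite gerBl.
have := @le_ln1Dx R (x - 1); rewrite (addrC 1) subrK; apply.
by rewrite ltrBrDr addNr.
Qed.

(** The exponent to which [X] must be raised to give [C * (2 + 4 * ln X) ^+ 66]: this is the [o(1)]
    of the theorem. *)
Definition log_excess (C X : R) : R :=
  ln (C * (2 + 4 * ln X) ^+ 66) / ln X.

Lemma cvg_log_excess (C : R) : 1 <= C -> log_excess C X @[X --> +oo] --> (0 : R).
Proof.
move=> C1; have C0 : 0 < C by apply: lt_le_trans C1.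
apply/cvgrPdist_le => e e0.
(* Here 396 = 66 * 6 collects the bounds [6 * s] on the 66 logarithms, so the numerator is at most
   [A * s] with [s] the square root of [ln X]. The choice of [T] forces [s >= A / e]. *)
pose A := ln C + 396.
have A0 : 0 < A by rewrite ltr_wpDl ?ln_ge0.
pose T := (A / e) ^+ 2 + 1.
near=> X.
have XT : expR T <= X by near: X; exact: nbhs_pinfty_ge.
have X0 : 0 < X by apply: lt_le_trans XT; exact: expR_gt0.
pose l := ln X; pose s := Num.sqrt l.
have lT : T <= l by rewrite /l -(expRK T) ler_ln ?posrE ?expR_gt0.
have l1 : 1 <= l by apply: le_trans lT; rewrite /T lerDr sqr_ge0.
have l0 : 0 <= l by exact: le_trans l1.
have s2 : s ^+ 2 = l by rewrite sqr_sqrtr.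
have s0 : 0 <= s by rewrite sqrtr_ge0.
have s1 : 1 <= s by rewrite -(sqrtr1 R); exact: ler_wsqrtr.
have sA : A / e <= s.
  have Ae : 0 <= A / e by rewrite divr_ge0 // ltW.
  rewrite -(ger0_norm Ae) -sqrtr_sqr; apply: ler_wsqrtr.
  by apply: le_trans lT; rewrite /T lerDl.
(* For [l >= 1], [2 + 4 * l <= (3 * s) ^+ 2], and [ln (3 * s) <= 3 * s]. *)
have h1 : ln (2 + 4 * l) <= 6 * s.
  apply: (@le_trans _ _ (ln ((3 * s) ^+ 2))).
    rewrite ler_ln ?posrE; [nra| by lra | by rewrite exprn_gt0 // mulr_gt0 //; lra].
  rewrite lnXn; last by lra.
  have : ln (3 * s) <= 3 * s by apply: ln_le_id; lra.
  by rewrite mulr2n; lra.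
have h0 : 0 <= ln (2 + 4 * l) by apply: ln_ge0; lra.
rewrite sub0r normrN /log_excess -/l lnM ?posrE ?exprn_gt0 //; last by lra.
rewrite lnXn; last by lra.
have N0 : 0 <= ln C + ln (2 + 4 * l) *+ 66.
  by rewrite addr_ge0 ?ln_ge0 // mulrn_wge0.
rewrite ger0_norm ?divr_ge0 // ler_pdivrMr; last by lra.
apply: (@le_trans _ _ (A * s)).
  have s1' : 0 <= s - 1 by rewrite subr_ge0.
  have c := mulr_ge0 (ln_ge0 C1) s1'.
  have -> : ln C + ln (2 + 4 * l) *+ 66 = ln C + 66 * ln (2 + 4 * l) by ring.
  rewrite /A; move: c h1; set u := ln C; set v := ln _ => c h1; nra.
have As : A <= e * s by rewrite mulrC -ler_pdivrMr.
rewrite -s2; nra.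
Unshelve. all: by end_near.
Qed.

Lemma powR_log_excess (C X : R) (n : nat) : 1 <= C -> 1 < X ->
  X `^ (n%:R + log_excess C X) = X ^+ n * (C * (2 + 4 * ln X) ^+ 66).
Proof.
move=> C1 X1; have X0 : 0 < X by apply: lt_trans X1.
have l0 : 0 < ln X by rewrite ln_gt0.
rewrite powRD ?(gt_eqF X0) ?implybT // powR_mulrn ?(ltW X0) //; congr (_ * _).
rewrite /powR (gt_eqF X0) /log_excess divfK ?gt_eqF // lnK // posrE.
rewrite mulr_gt0 ?exprn_gt0 //; last by lra.
by lra.
Qed.
End Asymptotics.

Theorem theorem1p2 (R : realType) (eta : nat) (heta : eta = 0%N \/ eta = 1%N) :
  exists delta : R -> R,
    delta X @[X --> +oo] --> (0 : R) /\
    \forall X \near +oo,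
      \sum_(0 <= p < (Num.truncn X).+1 | prime p) max_Theta8 R p eta
        <= X `^ (4 * eta%:R + 4 + delta X).
Proof.
have eta1 : (eta <= 1)%N by case: heta => ->.
pose C := 20 * weight_const R.
have C1 : 1 <= C.
  have : 1 <= 9 ^+ 18 :> R by apply: exprn_ege1; rewrite ler1n.
  by rewrite /C /weight_const; move: (9 ^+ 18) => u; lra.
exists (log_excess C); split; first exact: cvg_log_excess.
near=> X.
have X2 : 2 <= X by near: X; exact: nbhs_pinfty_ge.
have X0 : 0 <= X by lra.
set Y := Num.truncn X.
have Y0 : (0 < Y)%N by rewrite truncn_gt0; lra.
have YX : Y%:R <= X by have /andP[] := truncn_itv X0.
have -> : 4 * eta%:R + 4 = (4 * eta + 4)%:R :> R by rewrite natrD natrM.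
rewrite powR_log_excess; [|exact: C1|lra].
apply: le_trans (sum_max_Theta8_le R eta1 Y0) _.
rewrite -/C mulrCA; apply: ler_pM.
- by rewrite exprn_ge0.
- rewrite mulr_ge0 ?exprn_ge0 //; first lra.
  by apply: sumr_ge0 => i _; rewrite invr_ge0.
- by apply: lerXn2r; rewrite ?nnegrE.
rewrite ler_wpM2l //; first lra.
have N0 : (0 < 2 * Y ^ 4)%N by rewrite muln_gt0 expn_gt0 Y0.
have YR : 0 < Y%:R :> R by rewrite ltr0n.
have lnX : 0 <= ln X by apply: ln_ge0; lra.
apply: lerXn2r; rewrite ?nnegrE; [|lra|].
  by apply: sumr_ge0 => i _; rewrite invr_ge0.
(* The harmonic sum is at most [1 + ln 2 + 4 * ln Y], hence at most [2 + 4 * ln X]. *)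
apply: le_trans (harmonic_sum_le_ln R N0) _.
rewrite natrM natrX lnM ?posrE ?exprn_gt0 // lnXn //.
have ln2 : ln 2 <= 1 :> R.
  by have := @le_ln1Dx R 1; rewrite -natr1; apply; lra.
have : ln Y%:R <= ln X by rewrite ler_ln ?posrE //; lra.
by rewrite mulr2n; lra.
Unshelve. all: by end_near.
Qed.
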